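(* Let $\alpha\in\mathbb{R}$ and let $f\in H(\mathbb{D})$ be a $\mathcal{U}$-frequently hypercyclic function for $T_\alpha$. Then - if $\alpha\leq0$, then $\limsup_{r\to1^-}\big((1-r)^{-\alpha}M_1(f,r)\big)=+\infty$; - if $\alpha>0$, then $\limsup_{r\to1^-}M_1(f,r)>0$. For $\alpha\neq0$ these results are optimal in the following sense: for any positive integer $l\geq1$ there exist a $\mathcal{U}$-frequently hypercyclic function $f\in H(\mathbb{D})$ for $T_\alpha$ and a constant $C>0$ such that for every $0<r<1$ sufficiently large (i.e. sufficiently close to $1$) $$M_1(f,r)\leq\begin{cases}C(1-r)^{\alpha}\log_l(-\log(1-r))&\text{if }\alpha<0,\\ C&\text{if }\alpha>0.\end{cases}$$
   Context: $\mathbb{D}$ is the open unit disc in $\mathbb{C}$ and $H(\mathbb{D})$ is the Fréchet space of analytic functions on $\mathbb{D}$ with the topology of uniform convergence on compact subsets. For $\alpha\in\mathbb{R}$ and $n\ge1$ put $w_n(\alpha)=(1+\frac1n)^{\alpha}$; the weighted Taylor shift $T_\alpha:H(\mathbb{D})\to H(\mathbb{D})$ is $T_\alpha\big(\sum_{k\ge0}a_kz^k\big)=\sum_{k\ge0}a_{k+1}w_{k+1}(\alpha)z^k$. The upper density of $A\subset\mathbb{N}$ is $\overline d(A)=\limsup_{n\to\infty}\frac{\#(A\cap\{1,\dots,n\})}{n}$. A function $f\in H(\mathbb{D})$ is $\mathcal{U}$-frequently hypercyclic for $T_\alpha$ if for every non-empty open set $U\subset H(\mathbb{D})$, $\overline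 d(\{n\in\mathbb{N}:T_\alpha^nf\in U\})>0$. For $0<r<1$, $M_1(f,r)=\frac1{2\pi}\int_0^{2\pi}|f(re^{i\theta})|\,d\theta$. For a positive integer $l$, $\log_l=\log\circ\dots\circ\log$ ($l$ times). *)

(* Defs.v *)
From HB Require Import structures.
From mathcomp Require Import all_boot all_order all_algebra complex.
From mathcomp Require Import all_classical all_reals all_analysis.

Set Implicit Arguments.
Unset Strict Implicit.
Unset Printing Implicit Defensive.

Import Order.TTheory GRing.Theory Num.Theory numFieldNormedType.Exports.

Local Open Scope classical_set_scope.
Local Open Scope ring_scope.
Local Open Scope complex_scope.

(* [R[i]] gets the topology and norm that every [numFieldType] carries on its
   regular module. *)
HB.instance Definition _ (R : realType) :=
  PseudoPointedMetric.copy R[i] R[i]^o.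
HB.instance Definition _ (R : realType) := NormedModule.copy R[i] R[i]^o.

Section TaylorShift.
Variable R : realType.
Implicit Types (f : R[i] -> R[i]) (a : nat -> R[i]) (c z : R[i]).

Definition disc : set R[i] := [set z | `|z| < 1].

(* Elements of H(D) are represented by total functions on R[i]; their values
   outside the disc play no role. *)
Definition analytic_disc : set (R[i] -> R[i]) :=
  [set f | forall c, disc c -> exists a, \forall z \near c,
     series (fun k => a k * (z - c) ^+ k) @ \oo --> f z].

(* Functions with the topology of uniform convergence on the compact subsets
   of the disc; H(D) is its subspace [analytic_disc]. *)
Definition compact_convergence :=
  {family (fun K : set R[i] => compact K /\ K `<=` disc), R[i] -> R[i]}.

(* The sequence [a] such that f(z) = \sum_k a_k z^k on the disc. *)
Definition taylor_coef f : nat -> R[i] :=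
  get [set a | forall z, disc z ->
     series (fun k => a k * z ^+ k) @ \oo --> f z].

Definition shift_weight (alpha : R) (n : nat) : R := (1 + n%:R^-1) `^ alpha.

Definition taylor_shift (alpha : R) f : R[i] -> R[i] := fun z =>
  limn (series (fun k =>
    taylor_coef f k.+1 * (shift_weight alpha k.+1)%:C * z ^+ k)).

Definition upper_density (A : set nat) : \bar R :=
  limn_esup (fun n =>
    ((\sum_(1 <= k < n.+1) (k \in A))%N%:R / n%:R)%:E).

(* The non-empty open subsets of H(D) are the non-empty traces on
   [analytic_disc] of the open sets of [compact_convergence]. *)
Definition U_frequently_hypercyclic (alpha : R) f : Prop :=
  analytic_disc f /\
  forall U : set compact_convergence, open U -> U `&` analytic_disc !=set0 ->
    (0 < upper_density [set n | U (iter n (taylor_shift alpha) f)])%E.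

Definition M1 f (r : R) : R :=
  (2 * pi)^-1 * \int[lebesgue_measure]_(t in `[0, 2 * pi])
    ComplexField.Normc.normc (f (r%:C * (cos t +i* sin t))).

Definition iter_log (l : nat) (x : R) : R := iter l (@ln R) x.

End TaylorShift.

(* Main.v *)
Require Import Defs.
From mathcomp Require Import all_boot all_order all_algebra complex.
From mathcomp Require Import all_classical all_reals all_analysis.
From mathcomp Require Import ring lra.

Set Implicit Arguments.
Unset Strict Implicit.
Unset Printing Implicit Defensive.

Import Order.TTheory GRing.Theory Num.Theory numFieldNormedType.Exports.

(** The coefficient formula behind everything is
    [T_alpha^n f = \sum_k a_(n+k) ((n + k + 1) / (k + 1)) ^ alpha z ^ k] for
    [f = \sum_k a_k z ^ k]; in particular [T_alpha^n f 0 = a_n (n + 1) ^ alpha].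

    Lower bounds. A dense orbit meets [|g 0| > M] for infinitely many [n], so
    [|a_n| > M (n + 1) ^ (- alpha)] infinitely often. Since
    [|a_n| r ^ n <= M_1(f, r)] ([coef_le_M1]), the choice [r = 1 - 1 / (n + 1)],
    for which [r ^ n >= exp (-1)], gives the case [alpha <= 0]
    ([limsup_M1_infty]); for [alpha > 0] it is enough that one coefficient does
    not vanish ([limsup_M1_gt0]).

    Optimality. Upper density allows the orbit to be steered on very sparse
    windows only. To bring [T_alpha^n f] close to a polynomial
    [P = \sum_k p_k z ^ k] for [n = X + s j], [N <= j < 2 N], one inserts the
    block [X ^ (- alpha) z ^ X Q(z) K(z ^ s)], where [Q] has coefficients
    [p_k (k + 1) ^ alpha] and [K = (1 / N) (\sum_(i < 2 N) w ^ i)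
    (\sum_(l < N) w ^ l)] has coefficients equal to one on the window
    ([block_approx]). With [s] large the translates of [P] do not interact on a
    given smaller disc, and with [X = t N], [t] large, the weights are almost
    constant along the window. Parseval and the inequality of arithmetic and
    geometric means bound the circle means of [K] by a constant, whence
    [M_1 <= C X ^ (- alpha) r ^ X] with [C] independent of [N] ([M1_block]). As
    [N] grows this is absorbed by any [phi] such that
    [X ^ (- alpha) r ^ X = o(phi r)] uniformly in [r] ([majorant]), which covers
    both constants for [alpha > 0] and, for [alpha < 0], [(1 - r) ^ alpha] times
    any iterated logarithm of [- ln (1 - r)]. Placing blocks far apart, each
    request being served infinitely often, gives the function
    ([assembly], [majorant_realized]).

    Analyticity is a local notion here, whereas both the density of polynomials
    and the formula for [T_alpha] need global power series. That a locally
    analytic function on the disc is a power series ([taylor]) is obtained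
    without integration: repeated division by [z], the maximum principle, and
    Cauchy's estimates by averaging over roots of unity. *)

Local Open Scope classical_set_scope.
Local Open Scope ring_scope.

Local Notation normc := ComplexField.Normc.normc.

(** * The modulus as a real number, and limits in the complex numbers *)

Section ComplexNorm.
Variable R : realType.
Implicit Types (z c w : R[i]) (x y : R).

Lemma normrcE z : `|z| = (normc z)%:C%C. Proof. by case: z. Qed.

Lemma normc_ge0 z : 0 <= normc z.
Proof. by rewrite -lecR -normrcE; exact: normr_ge0. Qed.

Lemma normc_real x : normc x%:C%C = `|x|.
Proof. by rewrite /= expr0n /= addr0 sqrtr_sqr. Qed.

Lemma normcX z n : normc (z ^+ n) = normc z ^+ n.
Proof. by apply: complexI; rewrite rmorphXn /= -!normrcE normrX. Qed.

Lemma normc_sum (I : Type) (r : seq I) (P : pred I) (F : I -> R[i]) :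
  normc (\sum_(i <- r | P i) F i) <= \sum_(i <- r | P i) normc (F i).
Proof.
elim/big_rec2: _ => [|i y z _ le_zy]; first by rewrite ComplexField.Normc.normc0.
by rewrite (le_trans (le_normcD _ _))// lerD2l.
Qed.

Lemma normcB z w : normc (z - w) = normc (w - z).
Proof. by rewrite -(normcN (z - w)) opprB. Qed.

Lemma normc_eq0 z : (normc z == 0) = (z == 0).
Proof.
apply/eqP/eqP => [/ComplexField.Normc.eq0_normc //|->].
exact: ComplexField.Normc.normc0.
Qed.

Lemma normc_gt0 z : (0 < normc z) = (z != 0).
Proof. by rewrite lt_neqAle normc_ge0 andbT eq_sym normc_eq0. Qed.

Lemma normc_Re z : `|complex.Re z| <= normc z.
Proof. by have := normc_ge_Re z; rewrite normrcE lecR. Qed.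

Lemma normc_Im z : `|complex.Im z| <= normc z.
Proof.
have := normc_Re (z * 'i%C); rewrite ReiNIm normrN.
by rewrite ComplexField.Normc.normcM /= expr0n /= add0r expr1n sqrtr1 mulr1.
Qed.

Lemma normc_le_ReIm z : normc z <= `|complex.Re z| + `|complex.Im z|.
Proof.
have -> : normc z = normc ((complex.Re z)%:C%C + 'i%C * (complex.Im z)%:C%C) by rewrite -complexE.
rewrite (le_trans (le_normcD _ _)) // ComplexField.Normc.normcM !normc_real.
by rewrite /= expr0n /= add0r expr1n sqrtr1 mul1r.
Qed.

Lemma discP z : disc z <-> normc z < 1.
Proof. by rewrite /disc /= normrcE -[1]/(1%:C)%C ltcR. Qed.

Lemma posC (e : R[i]) : 0 < e -> exists2 x : R, 0 < x & e = x%:C%C.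
Proof.
move=> e0; have /complex_realP[x ex] := gtr0_real e0.
by exists x => //; rewrite -ltcR -ex.
Qed.

Lemma nbhscP c (A : set R[i]) : nbhs c A <->
  exists2 e : R, 0 < e & forall z, normc (z - c) < e -> A z.
Proof.
split=> [/nbhs_normP[e /= /posC[x x0 ->]] sub|[e e0 sub]].
  by exists x => // z zc; apply: sub => /=; rewrite distrC normrcE ltcR.
apply/nbhs_normP; exists e%:C%C; rewrite /= ?ltcR// => z /=.
by rewrite distrC normrcE ltcR => /sub.
Qed.

Lemma cvgcP (u : nat -> R[i]) l : u @ \oo --> l <->
  forall e : R, 0 < e -> exists n0, forall n, (n0 <= n)%N -> normc (u n - l) < e.
Proof.
split=> [ul e e0|ul].
  have /ul[n0 _ ball_n] : nbhs l [set z | normc (z - l) < e].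
    by apply/nbhscP; exists e.
  by exists n0 => n /ball_n.
move=> A /nbhscP[e /ul[n0 n0P] sub]; exists n0 => // n /= n0n.
exact/sub/n0P.
Qed.

Lemma Re_sum (I : Type) (r : seq I) (P : pred I) (F : I -> R[i]) :
  complex.Re (\sum_(i <- r | P i) F i) = \sum_(i <- r | P i) complex.Re (F i).
Proof. by elim/big_rec2: _ => // i x y _ <-; case: (F i) y => ? ? []. Qed.

Lemma Im_sum (I : Type) (r : seq I) (P : pred I) (F : I -> R[i]) :
  complex.Im (\sum_(i <- r | P i) F i) = \sum_(i <- r | P i) complex.Im (F i).
Proof. by elim/big_rec2: _ => // i x y _ <-; case: (F i) y => ? ? []. Qed.

End ComplexNorm.

(** * Power series dominated by geometric series *)

Section Geometric.
Variable R : realType.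
Implicit Types (a b : nat -> R[i]) (z c w : R[i]) (M q : R).

Lemma geo_sum_le q n m : 0 <= q < 1 ->
  \sum_(n <= k < n + m) q ^+ k <= q ^+ n / (1 - q).
Proof.
move=> /andP[q0 q1]; have q1' : 0 < 1 - q by rewrite subr_gt0.
rewrite -{1}[n]add0n big_addn addKn.
rewrite (eq_bigr (fun k => q ^+ n * q ^+ k)); last first.
  by move=> k _; rewrite addnC exprD.
rewrite -mulr_sumr ler_wpM2l ?exprn_ge0// -[leRHS]mul1r ler_pdivlMr//.
rewrite mulrC big_mkord -opprB mulNr -subrX1 opprB lerBlDr lerDl.
by rewrite exprn_ge0.
Qed.

Lemma real_geo_cvg (b : nat -> R) M q : 0 <= q < 1 ->
  (forall k, `|b k| <= M * q ^+ k) -> cvgn (series b).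
Proof.
move=> /andP[q0 q1] bM; apply: normed_cvg.
apply: (@series_le_cvg _ _ (geometric M q)) => //=.
- by move=> n; exact: le_trans (bM n).
- by apply: is_cvg_geometric_series; rewrite ger0_norm.
Qed.

(** Real and imaginary parts converge absolutely. The explicit tail bound is
    what makes every later convergence uniform on smaller discs. *)
Lemma geo_cvg b M q : 0 <= q < 1 -> (forall k, normc (b k) <= M * q ^+ k) ->
  exists l, forall n, normc (series b n - l) <= M * q ^+ n / (1 - q).
Proof.
move=> q01 bM; have /andP[q0 q1] := q01.
have /cvg_ex[lx xP] : cvgn (series (fun k => complex.Re (b k))).
  by apply: (@real_geo_cvg _ M q) => // k; exact: le_trans (normc_Re _) _.
have /cvg_ex[ly yP] : cvgn (series (fun k => complex.Im (b k))).
  by apply: (@real_geo_cvg _ M q) => // k; exact: le_trans (normc_Im _) _.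
pose l := (lx +i* ly)%C; exists l => n.
have M0 : 0 <= M by rewrite -[M]mulr1 -[X in M * X](expr0 q) (le_trans _ (bM 0%N))// normc_ge0.
apply/ler_addgt0Pr => e e0.
have e2 : 0 < e / 2 by rewrite divr_gt0.
move: xP => /cvgrPdist_lt /(_ _ e2)[n1 _ n1P].
move: yP => /cvgrPdist_lt /(_ _ e2)[n2 _ n2P].
pose m := maxn n1 n2.
have lm : normc (series b (n + m) - l) <= e.
  rewrite (le_trans (normc_le_ReIm _))//.
  have h1 := n1P (n + m)%N; have h2 := n2P (n + m)%N.
  rewrite /= in h1 h2.
  have -> : complex.Re (series b (n + m) - l) = complex.Re (series b (n + m)) - lx.
    by case: (series b _).
  have -> : complex.Im (series b (n + m) - l) = complex.Im (series b (n + m)) - ly.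
    by case: (series b _).
  rewrite /series /= Re_sum Im_sum distrC [X in _ + X]distrC [leRHS]splitr lerD// ltW//.
    by apply: h1; rewrite (leq_trans (leq_maxl n1 n2))// leq_addl.
  by apply: h2; rewrite (leq_trans (leq_maxr n1 n2))// leq_addl.
have -> : series b n - l = (series b n - series b (n + m)) + (series b (n + m) - l).
  by rewrite addrA subrK.
rewrite (le_trans (le_normcD _ _))// lerD//.
have -> : series b n - series b (n + m) = - \sum_(n <= k < n + m) b k.
  by rewrite -opprB sub_series_geq ?leq_addr.
rewrite normcN.
rewrite (le_trans (normc_sum _ _ _))// (le_trans (ler_sum _ (fun k _ => bM k)))//.
by rewrite -mulr_sumr -mulrA ler_wpM2l// geo_sum_le.
Qed.

End Geometric.

Section PowerSeries.
Variable R : realType.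
Implicit Types (a b : nat -> R[i]) (z c w : R[i]) (f g : R[i] -> R[i]).

Definition psum a n z := \sum_(0 <= k < n) a k * z ^+ k.

Definition sums a f := forall z, disc z -> psum a ^~ z @ \oo --> f z.

(** Coefficient sequences with radius of convergence at least one, as given
    by the Cauchy--Hadamard criterion. *)
Definition tame a := forall r : R, 0 < r < 1 ->
  exists2 M, 0 <= M & forall k, normc (a k) * r ^+ k <= M.

Lemma cvgc_unique (u : nat -> R[i]) (l l' : R[i]) :
  u @ \oo --> l -> u @ \oo --> l' -> l = l'.
Proof. by apply: cvg_unique; exact: norm_hausdorff. Qed.

(** Cauchy--Hadamard with an explicit geometric rate, hence uniformly on the
    closed disc of radius [s]. *)
Lemma psum_geo a (M r s : R) z : 0 <= s < r ->
  (forall k, normc (a k) * r ^+ k <= M) -> normc z <= s ->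
  exists2 l : R[i], psum a ^~ z @ \oo --> l &
    forall n, normc (psum a n z - l) <= M * (s / r) ^+ n / (1 - s / r).
Proof.
move=> /andP[s0 sr] aM zs; have r0 : 0 < r by exact: le_lt_trans sr.
have sr01 : 0 <= s / r < 1 by rewrite divr_ge0 ?(ltW r0)//= ltr_pdivrMr// mul1r.
have /(geo_cvg sr01)[l lP] : forall k, normc (a k * z ^+ k) <= M * (s / r) ^+ k.
  move=> k; rewrite ComplexField.Normc.normcM normcX expr_div_n mulrCA.
  rewrite mulrC ler_pM ?exprn_ge0 ?normc_ge0//.
    by rewrite lerXn2r ?nnegrE ?normc_ge0.
  by rewrite ler_pdivlMr ?exprn_gt0.
exists l; last exact: lP.
apply/cvgcP => e e0.
have : geometric (M / (1 - s / r)) (s / r) @ \oo --> 0.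
  by apply: cvg_geometric; rewrite ger0_norm; case/andP: sr01.
move=> /cvgrPdist_lt /(_ _ e0)[n0 _ n0P]; exists n0 => k /n0P /=.
rewrite sub0r normrN => le_e; rewrite (le_lt_trans (lP k))//.
by rewrite (le_lt_trans _ le_e)// mulrAC ler_norm.
Qed.

Lemma psum_tail a (M r s : R) z (l : R[i]) n : 0 <= s < r ->
  (forall k, normc (a k) * r ^+ k <= M) -> normc z <= s ->
  psum a ^~ z @ \oo --> l ->
  normc (psum a n z - l) <= M * (s / r) ^+ n / (1 - s / r).
Proof.
by move=> sr aM zs al; have [l' /(cvgc_unique al)-> ] := psum_geo sr aM zs.
Qed.

Lemma tame_sums a : tame a -> exists f, sums a f.
Proof.
move=> ta; suff : forall z, exists l : R[i], disc z -> psum a ^~ z @ \oo --> l.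
  by move=> H; have [f fP] := choice H; exists f.
move=> z; have [zd|//] := pselect (disc z); last by move=> ?; exists 0.
have z1 : normc z < 1 by apply/discP.
have z0 := normc_ge0 z; pose r := (1 + normc z) / 2.
have [|M M0 aM] := ta r; first by rewrite /r; lra.
have [|l al _] := @psum_geo a M r (normc z) z _ aM (lexx _).
  by rewrite /r; lra.
by exists l.
Qed.

Lemma cvg_terms_bounded b (l : R[i]) : series b @ \oo --> l ->
  exists2 M, 0 <= M & forall k, normc (b k) <= M.
Proof.
move=> /cvgcP /(_ 1 ltr01)[n0 n0P].
exists (2 + \sum_(k < n0) normc (b k)).
  by rewrite addr_ge0// sumr_ge0// => i _; exact: normc_ge0.
move=> k; have [kn|nk] := ltnP k n0.
  rewrite (bigD1 (Ordinal kn))//= addrCA lerDl addr_ge0// sumr_ge0// => i _.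
  exact: normc_ge0.
have -> : b k = (series b k.+1 - l) + - (series b k - l).
  by rewrite /series /= big_nat_recr//=; ring.
rewrite (le_trans (le_normcD _ _))// normcN ler_wpDr//.
  by rewrite sumr_ge0// => i _; exact: normc_ge0.
have := n0P _ nk; have := n0P _ (leqW nk); lra.
Qed.

Lemma sums_tame a f : sums a f -> tame a.
Proof.
move=> af r /andP[r0 r1].
have /af/cvg_terms_bounded[M M0 aM] : disc (r%:C%C : R[i]).
  by apply/discP; rewrite normc_real ger0_norm ?ltW//.
exists M => // k; have := aM k.
by rewrite /= ComplexField.Normc.normcM normcX normc_real (ger0_norm (ltW r0)).
Qed.

End PowerSeries.

(** * Roots of unity *)

Section Expi.
Variable R : realType.
Implicit Types t x : R.

Definition expi t : R[i] := (cos t +i* sin t)%C.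

Lemma expiD t x : expi (t + x) = expi t * expi x.
Proof. by rewrite /expi sinD cosD addrC [in LHS]addrC; congr Complex; ring. Qed.

Lemma expi0 : expi 0 = 1.
Proof. by rewrite /expi cos0 sin0. Qed.

Lemma expiX t n : expi t ^+ n = expi (n%:R * t).
Proof.
elim: n => [|n IH]; first by rewrite mul0r expi0.
by rewrite exprS IH -expiD; congr expi; rewrite -natr1; ring.
Qed.

Lemma normc_expi t : normc (expi t) = 1.
Proof. by rewrite /expi /= cos2Dsin2 sqrtr1. Qed.

Lemma expi2pi : expi (2 * pi) = 1.
Proof. by rewrite mulr_natl /expi cos2pi sin2pi. Qed.

Lemma expi_neq1 t : 0 < t < 2 * pi -> expi t != 1.
Proof.
move=> /andP[t0 t1]; apply/eqP => -[c _].
have : 0 < sin (t / 2) by apply: sin_gt0_pi; apply/andP; split; lra.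
have := cos_mulr2n (t / 2).
rewrite (_ : t / 2 *+ 2 = t); last by rewrite -mulr_natr divfK.
rewrite c cos2sin2 => h s0.
have : sin (t / 2) ^+ 2 = 0 by lra.
by move/eqP; rewrite expf_eq0 /= => /eqP s00; rewrite s00 ltxx in s0.
Qed.

Lemma sum_root_unity N j : (0 < j < N)%N ->
  \sum_(m < N) expi (2 * pi / N%:R) ^+ (j * m) = 0.
Proof.
move=> /andP[j0 jN]; set w := expi _; have N0 : (0 < N)%N by exact: leq_ltn_trans jN.
have wN : w ^+ N = 1 by rewrite expiX mulrC divfK ?pnatr_eq0 -?lt0n// expi2pi.
have wj : w ^+ j - 1 != 0.
  rewrite subr_eq0 expiX expi_neq1// mulrA; apply/andP; split.
    by rewrite !(divr_gt0, mulr_gt0) ?ltr0n// pi_gt0.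
  rewrite ltr_pdivrMr ?ltr0n// [ltRHS]mulrC ltr_pM2r ?ltr_nat//.
  by rewrite mulr_gt0// pi_gt0.
apply: (mulfI wj); rewrite mulr0 (eq_bigr (fun m : 'I_N => (w ^+ j) ^+ m)).
  by rewrite -subrX1 exprAC wN expr1n subrr.
by move=> m _; rewrite exprM.
Qed.

End Expi.

(** * Local power series expansions *)

Section Expansion.
Variable R : realType.
Implicit Types (a b : nat -> R[i]) (z c w : R[i]) (f g : R[i] -> R[i]).

(** A power series expansion at [c], valid in the open disc of radius [r],
    with the Cauchy-type bound on the coefficients that makes it
    quantitative. *)
Definition expansion f c b (r M : R) := [/\ 0 < r,
  forall k, normc (b k) * r ^+ k <= M &
  forall z, normc (z - c) < r -> psum b ^~ (z - c) @ \oo --> f z].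

Definition analytic_at f c := exists b r M, expansion f c b r M.

Lemma analytic_discP f : analytic_disc f <-> forall c, disc c -> analytic_at f c.
Proof.
split=> [fA c /fA[b /nbhscP[e e0 eP]]|fA c /fA[b [r [M [r0 bM bf]]]]]; last first.
  by exists b; apply/nbhscP; exists r.
have e2 : 0 < e / 2 by rewrite divr_gt0.
have h : c + (e / 2)%:C%C - c = (e / 2)%:C%C by rewrite addrC addKr.
have hn : normc (e / 2)%:C%C = e / 2 by rewrite normc_real gtr0_norm.
have /eP/cvg_terms_bounded[M _ bM] : normc (c + (e / 2)%:C%C - c) < e.
  by rewrite h hn; lra.
exists b, (e / 2), M; split=> // [k|z zc].
  by have := bM k; rewrite h ComplexField.Normc.normcM normcX hn.
by apply: eP; rewrite (lt_trans zc)//; lra.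
Qed.

Lemma expansion_center f c b r M : expansion f c b r M -> b 0%N = f c.
Proof.
case=> r0 _ /(_ c); rewrite subrr ComplexField.Normc.normc0 => /(_ r0) bf.
apply: (cvgc_unique _ bf); apply/cvgcP => e e0; exists 1%N => -[//|n] _.
rewrite /psum big_nat_recl//= expr0 mulr1 big1 ?addr0 ?subrr ?ComplexField.Normc.normc0//.
by move=> i _; rewrite expr0n mulr0.
Qed.

Lemma expansion_ge0 f c b r M : expansion f c b r M -> 0 <= M.
Proof.
case=> _ bM _; have := bM 0%N; rewrite expr0 mulr1; exact: le_trans (normc_ge0 _).
Qed.

Lemma expansion_shrink f c b r M r' : 0 < r' <= r ->
  expansion f c b r M -> expansion f c b r' M.
Proof.
move=> /andP[r'0 r'r] [r0 bM bf]; split=> // [k|z zc].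
  rewrite (le_trans _ (bM k))// ler_wpM2l ?normc_ge0// lerXn2r// nnegrE ltW//.
by apply: bf; exact: lt_le_trans zc _.
Qed.

Lemma analytic_continuous f c : analytic_at f c -> forall e : R, 0 < e ->
  exists2 d : R, 0 < d & forall z, normc (z - c) < d -> normc (f z - f c) < e.
Proof.
move=> [b [r [M fb]]] e e0; have M0 := expansion_ge0 fb.
have := fb => -[r0 bM bf].
pose d := Num.min (r / 2) (e * r / (4 * (M + 1))).
have d0 : 0 < d.
  by rewrite lt_min divr_gt0//= divr_gt0 ?mulr_gt0// ltr_wpDl.
exists d => // z zd.
have zr2 : normc (z - c) <= r / 2.
  by rewrite ltW// (lt_le_trans zd)// ge_min lexx.
have zr : normc (z - c) < r by lra.
have := @psum_tail _ b M r (normc (z - c)) (z - c) (f z) 1%N.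
move=> /(_ _ bM (lexx _) (bf _ zr)).
rewrite normc_ge0 zr => /(_ isT); rewrite expr1 /psum big_nat1 expr0 mulr1.
rewrite (expansion_center fb) (normcB (f c)) => /le_lt_trans; apply.
set x := normc (z - c) in zd zr2 zr *.
have xe : x < e * r / (4 * (M + 1)) by rewrite (lt_le_trans zd)// ge_min lexx orbT.
have x0 : 0 <= x by exact: normc_ge0.
have x2 : x / r <= 1 / 2 by rewrite ler_pdivrMr//; lra.
rewrite ltr_pdivrMr; last by lra.
move: xe; rewrite ltr_pdivlMr; last by lra.
move=> xe; have {}xe : x / r * (4 * (M + 1)) < e.
  by rewrite mulrAC ltr_pdivrMr.
have : 0 <= x / r by rewrite divr_ge0// ltW.
set y := x / r in x2 xe *; move=> y0.
have : M * y <= (M + 1) * y by rewrite ler_wpM2r//; lra.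
have : e * (1 / 2) <= e * (1 - y) by rewrite ler_wpM2l//; lra.
lra.
Qed.

Lemma expansion_rot f c b r M w : normc w = 1 -> expansion f (w * c) b r M ->
  expansion (fun z => f (w * z)) c (fun k => b k * w ^+ k) r M.
Proof.
move=> w1 [r0 bM bf]; split=> // [k|z zc].
  by rewrite ComplexField.Normc.normcM normcX w1 expr1n mulr1.
have : normc (w * z - w * c) < r.
  by rewrite -mulrBr ComplexField.Normc.normcM w1 mul1r.
move=> /bf; rewrite -mulrBr; apply: cvg_trans; apply: near_eq_cvg.
by near=> n; apply: eq_bigr => k _; rewrite exprMn mulrA.
Unshelve. all: end_near. Qed.

Lemma psumD a b n z : psum (fun k => a k + b k) n z = psum a n z + psum b n z.
Proof. by rewrite /psum -big_split; apply: eq_bigr => k _; rewrite mulrDl. Qed.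

Lemma psumZ w b n z : psum (fun k => w * b k) n z = w * psum b n z.
Proof. by rewrite /psum mulr_sumr; apply: eq_bigr => k _; rewrite mulrA. Qed.

Lemma cvgcD (u v : nat -> R[i]) (l l' : R[i]) :
  u @ \oo --> l -> v @ \oo --> l' -> (fun n => u n + v n) @ \oo --> l + l'.
Proof.
move=> /cvgcP ul /cvgcP vl; apply/cvgcP => e e0.
have e2 : 0 < e / 2 by rewrite divr_gt0.
have [n1 n1P] := ul _ e2; have [n2 n2P] := vl _ e2.
exists (maxn n1 n2) => n; rewrite geq_max => /andP[/n1P h1 /n2P h2].
rewrite opprD addrACA (le_lt_trans (le_normcD _ _))//; lra.
Qed.

Lemma cvgcM w (u : nat -> R[i]) (l : R[i]) :
  u @ \oo --> l -> (fun n => w * u n) @ \oo --> w * l.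
Proof.
move=> /cvgcP ul; apply/cvgcP => e e0.
have w0 := normc_ge0 w.
have [|n0 n0P] := ul (e / (normc w + 1)); first by rewrite divr_gt0//; lra.
exists n0 => n /n0P; rewrite -mulrBr ComplexField.Normc.normcM.
rewrite ltr_pdivlMr; last by lra.
apply: le_lt_trans; rewrite mulrC ler_wpM2l ?normc_ge0//; lra.
Qed.

Lemma analytic_add f g c : analytic_at f c -> analytic_at g c ->
  analytic_at (fun z => f z + g z) c.
Proof.
move=> [a [r [M fa]]] [b [s [N gb]]].
have r0 : 0 < r by case: fa. have s0 : 0 < s by case: gb.
pose m := Num.min r s; have m0 : 0 < m by rewrite lt_min r0.
have [|_ aM af] := @expansion_shrink _ _ _ _ _ m _ fa.
  by rewrite m0 ge_min lexx.
have [|_ bN bg] := @expansion_shrink _ _ _ _ _ m _ gb.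
  by rewrite m0 ge_min lexx orbT.
exists (fun k => a k + b k), m, (M + N); split=> [|k|z zc]; first exact: m0.
  rewrite (le_trans _ (lerD (aM k) (bN k)))// -mulrDl ler_wpM2r ?le_normcD//.
  by rewrite exprn_ge0// ltW.
rewrite (_ : psum _ ^~ _ = fun n => psum a n (z - c) + psum b n (z - c)).
  by apply: cvgcD; [exact: af|exact: bg].
by apply/funext => n; rewrite psumD.
Qed.

Lemma psum0 n z : psum (fun=> 0 : R[i]) n z = 0.
Proof. by rewrite /psum big1// => k _; rewrite mul0r. Qed.

Lemma analytic_zero c : analytic_at (fun=> 0) c.
Proof.
exists (fun=> 0), 1, 0; split=> [|k|z _]; first exact: ltr01.
  by rewrite ComplexField.Normc.normc0 mul0r.
by apply/cvgcP => e e0; exists 0%N => n _; rewrite psum0 subrr ComplexField.Normc.normc0.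
Qed.

Lemma analytic_sum (F : nat -> R[i] -> R[i]) n c :
  (forall m, analytic_at (F m) c) -> analytic_at (fun z => \sum_(m < n) F m z) c.
Proof.
move=> FA; elim: n => [|n IH].
  by under eq_fun do rewrite big_ord0; exact: analytic_zero.
rewrite (_ : (fun z => _) = fun z => (\sum_(m < n) F m z) + F n z).
  exact: (analytic_add IH (FA n)).
by apply/funext => z; rewrite big_ord_recr.
Qed.

End Expansion.

(** * Division of an analytic function by the variable *)

Section Division.
Variable R : realType.
Implicit Types (a b : nat -> R[i]) (z c w : R[i]) (f g : R[i] -> R[i]).

Lemma psum_cvg0 b : psum b ^~ 0 @ \oo --> b 0%N.
Proof.
apply/cvgcP => e e0; exists 1%N => -[//|n] _.
rewrite /psum big_nat_recl//= expr0 mulr1 big1 ?addr0 ?subrr ?ComplexField.Normc.normc0//.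
by move=> i _; rewrite expr0n mulr0.
Qed.

Lemma cvgcS (u : nat -> R[i]) (l : R[i]) :
  u @ \oo --> l -> (fun n => u n.+1) @ \oo --> l.
Proof.
by move=> /cvgcP ul; apply/cvgcP => e /ul[n0 n0P]; exists n0 => n /leqW/n0P.
Qed.

Lemma cvgc_cst w : (fun _ : nat => w) @ \oo --> w.
Proof.
by apply/cvgcP => e e0; exists 0%N => n _; rewrite subrr ComplexField.Normc.normc0.
Qed.

Lemma psumS b n z : psum b n.+1 z = b 0%N + z * psum (fun k => b k.+1) n z.
Proof.
rewrite /psum big_nat_recl// expr0 mulr1 mulr_sumr; congr (_ + _).
by apply: eq_bigr => k _; rewrite exprS mulrCA.
Qed.

(** Removing the constant term and dividing by the variable stays within
    analytic functions: at the origin the coefficients are shifted, at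
    [c != 0] dividing by [c + h] amounts to the first order recursion
    [c d_k + d_(k-1) = b_k], which keeps the coefficients geometric once the
    radius is at most [|c| / 2]. *)
Lemma analytic_div f : (forall c, disc c -> analytic_at f c) ->
  exists2 g : R[i] -> R[i], (forall c, disc c -> analytic_at g c) &
    forall z, f z = f 0 + z * g z.
Proof.
move=> fA.
have [b [r [M fb]]] : analytic_at f 0.
  by apply: fA; apply/discP; rewrite ComplexField.Normc.normc0.
have b0 := expansion_center fb; have := fb => -[r0 bM bf].
pose g z := if z == 0 then b 1%N else (f z - f 0) / z.
have fg z : f z = f 0 + z * g z.
  rewrite /g; case: eqVneq => [->|z0]; first by rewrite mul0r addr0.
  by rewrite mulrCA divff// mulr1 addrC subrK.
exists g => [c cd|z]; last exact: fg.
have [->|c0] := eqVneq c 0.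
  have bM' k : normc (b k.+1) * r ^+ k <= M / r.
    by rewrite ler_pdivlMr// -mulrA -exprSr.
  exists (fun k => b k.+1), r, (M / r); split=> [||z zr]; [exact: r0|exact: bM'|].
  have [|l bl _] := @psum_geo _ (fun k => b k.+1) _ r (normc (z - 0)) (z - 0) _ bM' (lexx _).
    by rewrite normc_ge0.
  suff -> : g z = l by [].
  have [z0|z0] := eqVneq z 0.
    rewrite z0 subr0 in bl; rewrite /g z0 eqxx.
    apply: (@cvgc_unique _ (psum (fun k => b k.+1) ^~ 0)); [exact: psum_cvg0|exact: bl].
  apply: (mulfI z0); apply: (@addrI _ (f 0)); rewrite -fg.
  apply: cvgc_unique (cvgcS (bf _ zr)) _.
  under eq_fun do rewrite psumS.
  by rewrite b0; apply: cvgcD; [exact: cvgc_cst|rewrite -[X in X * l](subr0 z); exact: cvgcM].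
have [a [s [N fa]]] := fA c cd.
have c0' : 0 < normc c by rewrite normc_gt0.
pose t := Num.min s (normc c / 2).
have t0 : 0 < t by rewrite lt_min divr_gt0// andbT; case: fa.
have [|_ aN af] := @expansion_shrink _ _ _ _ _ _ t _ fa.
  by rewrite t0 ge_min lexx.
have tc : t <= normc c / 2 by rewrite ge_min lexx orbT.
pose a' k := if k is 0%N then a 0%N - f 0 else a k.
pose N' := N + normc (f 0).
have a'N k : normc (a' k) * t ^+ k <= N'.
  case: k => [|k] /=; last by rewrite ler_wpDr ?normc_ge0.
  rewrite expr0 mulr1 (le_trans (le_normcD _ _))// normcN lerD2r.
  by have := aN 0%N; rewrite expr0 mulr1.
have N'0 : 0 <= N' by rewrite (le_trans _ (a'N 0%N))// mulr_ge0 ?normc_ge0// expr0.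
have a'f z : normc (z - c) < t -> psum a' ^~ (z - c) @ \oo --> f z - f 0.
  move=> /af zf; suff : (fun n => psum a' n.+1 (z - c)) @ \oo --> f z - f 0.
    move=> /cvgcP h; apply/cvgcP => e /h[n0 n0P]; exists n0.+1 => -[//|n].
    exact: n0P.
  rewrite (_ : (fun n => _) = fun n => psum a n.+1 (z - c) + (- f 0)).
    by apply: cvgcD; [exact: (cvgcS zf)|exact: cvgc_cst].
  by apply/funext => n; rewrite !psumS addrAC.
pose d := fix d k := if k is k'.+1 then (a k - d k') / c else (a 0%N - f 0) / c.
pose D := 2 * N' / normc c.
have dD k : normc (d k) * t ^+ k <= D.
  elim: k => [|k IH].
    have := a'N 0%N; rewrite expr0 !mulr1 /= ComplexField.Normc.normcM ComplexField.Normc.normcV.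
    by move=> h; rewrite /D ler_wpM2r ?invr_ge0 ?normc_ge0//; lra.
  rewrite /= ComplexField.Normc.normcM ComplexField.Normc.normcV mulrAC ler_pdivrMr//.
  rewrite (@le_trans _ _ ((normc (a k.+1) + normc (d k)) * t ^+ k.+1))//.
    by rewrite ler_wpM2r ?exprn_ge0 ?(ltW t0)// (le_trans (le_normcD _ _))// normcN.
  have IH' : normc (d k) * t ^+ k.+1 <= D * t.
    by rewrite exprSr mulrA ler_wpM2r// ltW.
  rewrite mulrDl; apply: (le_trans (lerD (a'N k.+1) IH')).
  rewrite /D divfK ?gt_eqF//.
  have : 2 * N' / normc c * t <= 2 * N' / normc c * (normc c / 2).
    by rewrite ler_wpM2l// !mulr_ge0// invr_ge0 ltW.
  rewrite (_ : 2 * N' / normc c * (normc c / 2) = N'); last first.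
    by field; rewrite gt_eqF.
  lra.
exists d, t, D; split=> [||z zt]; [exact: t0|exact: dD|].
have [|l dl _] := @psum_geo _ d _ t (normc (z - c)) (z - c) _ dD (lexx _).
  by rewrite normc_ge0.
have z0 : z != 0.
  apply: contraTneq zt => ->; rewrite sub0r normcN -leNgt (le_trans tc)//; lra.
suff -> : g z = l by [].
apply: (mulfI z0); apply: (@addrI _ (f 0)); rewrite -fg.
apply: (@addIr _ (- f 0)); rewrite [RHS]addrAC subrr add0r.
apply: cvgc_unique (a'f _ zt) _.
have -> : psum a' ^~ (z - c) =
    fun n => z * psum d n (z - c) + (- (z - c)) * (psum d n (z - c) - psum d n.-1 (z - c)).
  apply/funext => n; elim: n => [|n IH].
    by rewrite /psum !big_geq// subrr !mulr0 addr0.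
  rewrite /psum !big_nat_recr//= -/(psum _ _ _) -/(psum _ _ _) IH.
  rewrite [psum d n _ + _ - _]addrAC subrr add0r.
  case: n {IH} => [|n].
    by rewrite /psum !big_geq//= expr0 mulr1; field.
  rewrite /psum !big_nat_recr//= -/(psum _ _ _).
  set p := psum _ _ _; rewrite exprS; set y := (z - c) ^+ n; set h := z - c.
  have -> : c = z - h by rewrite /h opprB addrC subrK.
  by field; rewrite /h opprB addrC subrK.
rewrite -[X in _ --> X]addr0; apply: cvgcD; first exact: cvgcM.
rewrite -(mulr0 (- (z - c))); apply: cvgcM.
apply/cvgcP => e e0; have /cvgcP/(_ (e / 2)) := dl.
case=> [|n0 n0P]; first by rewrite divr_gt0.
exists n0.+1 => -[//|n] nn; rewrite subr0.
have := n0P n.+1 (ltnW nn); have := n0P n nn; rewrite -(normcN (_ n _ - l)).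
move=> h1 h2; rewrite (_ : _ - _ = (psum d n.+1 (z - c) - l) + - (psum d n (z - c) - l)).
  by rewrite (le_lt_trans (le_normcD _ _))//; lra.
by rewrite opprB addrA subrK.
Qed.

End Division.

(** * The maximum principle *)

Section MaxPrinciple.
Variable R : realType.
Implicit Types (a b : nat -> R[i]) (z c w : R[i]) (f g : R[i] -> R[i]).

(** If [b_j] is the first non-zero coefficient after [b_0 = f c], moving from
    [c] in a direction [u] with [u ^ j] aligned with [b_0 / b_j] increases
    the modulus; so at a local maximum there is no such [j]. *)
Lemma local_max_const f c (d : R) : analytic_at f c -> 0 < d ->
  (forall z, normc (z - c) < d -> normc (f z) <= normc (f c)) ->
  exists2 e : R, 0 < e & forall z, normc (z - c) < e -> f z = f c.
Proof.
move=> [b [r [M fb]]] d0 fmax.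
have bc := expansion_center fb; have M0 := expansion_ge0 fb.
have [r0 bM bf] := fb.
have [fc0|fc0] := eqVneq (f c) 0.
  exists d => // z /fmax; rewrite fc0 ComplexField.Normc.normc0 => h.
  by apply/eqP; rewrite -normc_eq0 eq_le h normc_ge0.
have [ex|nex] := pselect (exists k, (0 < k)%N && (b k != 0)); last first.
  exists r => // z /bf zf; apply: (cvgc_unique zf).
  apply/cvgcP => e e0; exists 1%N => -[//|n] _.
  rewrite psumS /psum big1 ?mulr0 ?addr0 ?bc ?subrr ?ComplexField.Normc.normc0//.
  move=> k _; have [->|bk] := eqVneq (b k.+1) 0; first by rewrite mul0r.
  by case: nex; exists k.+1.
have [j /andP[j0 bj] jmin] := ex_minnP ex.
exfalso.
have nbj : 0 < normc (b j) by rewrite normc_gt0.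
have nfc : 0 < normc (f c) by rewrite normc_gt0.
pose v := f c / b j * (normc (b j) / normc (f c))%:C%C.
have v1 : normc v = 1.
  rewrite !ComplexField.Normc.normcM ComplexField.Normc.normcV normc_real.
  by rewrite ger0_norm ?divr_ge0 ?ltW//; field; rewrite !gt_eqF.
pose u := j.-root v.
have uj : u ^+ j = v by rewrite rootCK.
have u1 : normc u = 1.
  have /eqP := congr1 (@normc R) uj; rewrite normcX v1.
  by rewrite pexpr_eq1 ?normc_ge0// => /eqP.
(* The last bound makes the tail of order [t ^ (j + 1)] smaller than the gain
   [t ^ j |b_j|]. *)
pose t := Num.min (r / 2) (Num.min (d / 2) (normc (b j) * r ^+ j.+1 / (4 * (M + 1)))).
have t0 : 0 < t.
  rewrite !lt_min !divr_gt0//= ?mulr_gt0 ?exprn_gt0//; lra.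
have tr2 : t <= r / 2 by rewrite /t ge_min lexx.
have td2 : t <= d / 2 by rewrite /t !ge_min lexx orbT.
have tb : t <= normc (b j) * r ^+ j.+1 / (4 * (M + 1)).
  by rewrite /t !ge_min lexx !orbT.
move: t t0 tr2 td2 tb => t t0 tr2 td2 tb.
pose h := t%:C%C * u.
have nh : normc h = t.
  by rewrite ComplexField.Normc.normcM u1 normc_real gtr0_norm// mulr1.
have hc : c + h - c = h by rewrite addrC addKr.
have Ph : psum b j.+1 h = f c * (1 + t ^+ j * normc (b j) / normc (f c))%:C%C.
  rewrite /psum big_nat_recr//= big_ltn// big_nat_cond big1 ?addr0.
    rewrite expr0 mulr1 exprMn uj bc -rmorphXn /= /v.
    rewrite (_ : (1 + _)%:C%C = 1 + (t ^+ j)%:C%C * (normc (b j) / normc (f c))%:C%C).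
      by field; rewrite bj andbT fmorph_eq0 gt_eqF.
    by rewrite rmorphD rmorph1 -rmorphM mulrA.
  move=> k; rewrite andbT => /andP[k0 kj].
  have [->|bk] := eqVneq (b k) 0; first by rewrite mul0r.
  by have := jmin k; rewrite k0 bk => /(_ isT); rewrite leqNgt kj.
have nPh : normc (psum b j.+1 h) = normc (f c) + t ^+ j * normc (b j).
  rewrite Ph ComplexField.Normc.normcM normc_real ger0_norm.
    by field; rewrite gt_eqF.
  by rewrite addr_ge0// divr_ge0 ?mulr_ge0 ?exprn_ge0// ltW.
have hr : normc (c + h - c) < r by rewrite hc nh; lra.
have tail : normc (psum b j.+1 h - f (c + h)) <= M * (t / r) ^+ j.+1 / (1 - t / r).
  have := bf _ hr; rewrite hc => bfh.
  by apply: (psum_tail _ _ bM _ bfh); [rewrite (ltW t0)/=; lra|rewrite nh].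
have : normc (f (c + h)) <= normc (f c) by apply: fmax; rewrite hc nh; lra.
have : normc (psum b j.+1 h) <= normc (psum b j.+1 h - f (c + h)) + normc (f (c + h)).
  by rewrite (le_trans _ (le_normcD _ _))// subrK.
rewrite nPh; suff : M * (t / r) ^+ j.+1 / (1 - t / r) < t ^+ j * normc (b j) by lra.
have y2 : t / r <= 1 / 2 by rewrite ler_pdivrMr//; lra.
rewrite ltr_pdivrMr; last by lra.
rewrite expr_div_n exprS mulrA ltr_pdivrMr ?exprn_gt0//.
have tj : 0 < t ^+ j by rewrite exprn_gt0.
rewrite (_ : M * (t * t ^+ j) = t ^+ j * (M * t)); last by ring.
rewrite -!mulrA ltr_pM2l//.
have rj : 0 < r ^+ j.+1 by rewrite exprn_gt0.
move: tb; rewrite ler_pdivlMr; last by lra.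
set q := r ^+ j.+1 in rj *; set B := normc (b j) in nbj *; set y := t / r in y2 *.
have Bq : 0 < B * q by rewrite mulr_gt0.
have : B * q * (1 / 2) <= B * q * (1 - y) by rewrite (ler_wpM2l (ltW Bq))//; lra.
have : 0 <= t * M by rewrite mulr_ge0// ltW.
lra.
Qed.

Lemma normc_continuous : continuous (@normc R).
Proof.
move=> p A /nbhs_ballP[e /= e0 sub]; apply/nbhscP; exists e => // q qe.
apply: sub; rewrite /ball /= (le_lt_trans _ qe)//.
rewrite distrC ler_norml; apply/andP; split.
  by rewrite lerNl opprB lerBlDr normcB (le_trans _ (le_normcD _ _))// subrK.
by rewrite lerBlDr (le_trans _ (le_normcD _ _))// subrK.
Qed.

(** Pulled back to the plane, the closed disc is a closed subset of a square. *)
Lemma compact_closed_disc (r : R) : compact [set z : R[i] | normc z <= r].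
Proof.
pose phi (p : R * R) : R[i] := (p.1 +i* p.2)%C.
have cphi : continuous phi.
  move=> p A /nbhscP[e e0 sub].
  have : nbhs p (ball p (e / 2)) by apply: nbhsx_ballx; rewrite divr_gt0.
  apply: filterS => q [/= h1 h2]; apply: sub.
  rewrite (le_lt_trans (normc_le_ReIm _))//= [ltRHS]splitr ltrD//.
    by rewrite distrC.
  by rewrite distrC.
pose sq : set (R * R) := `[-r, r] `*` `[-r, r].
pose nsq (p : R * R) := normc (phi p).
have cnsq : continuous nsq.
  by move=> p; apply: (@continuous_comp _ _ _ phi (@normc R)); [exact: cphi|exact: normc_continuous].
have -> : [set z : R[i] | normc z <= r] = phi @` (sq `&` nsq @^-1` [set x | x <= r]).
  apply/seteqP; split=> [[x y] /= zr|z [p [_ pr] <-]//].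
  exists (x, y) => //; split=> //=; split=> /=; rewrite in_itv /= -ler_norml.
    exact: le_trans (normc_Re (x +i* y)%C) zr.
  exact: le_trans (normc_Im (x +i* y)%C) zr.
apply: continuous_compact; first by apply: continuous_subspaceT.
apply: compact_closedI.
  by apply: compact_setX; exact: segment_compact.
by apply: preimage_closed => //; exact: closed_le.
Qed.

Lemma analytic_within f r : r < 1 ->
  (forall c, disc c -> analytic_at f c) ->
  {within [set z : R[i] | normc z <= r], continuous (fun z => normc (f z))}.
Proof.
move=> r1 fA; apply: continuous_in_subspaceT => z; rewrite inE /= => zr.
apply: (@continuous_comp _ _ _ f (@normc R)); last exact: normc_continuous.
have /fA/analytic_continuous fc : disc z by apply/discP; exact: le_lt_trans zr r1.
move=> A /nbhscP[e /fc[d d0 dP] sub]; apply/nbhscP; exists d => // w /dP.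
exact: sub.
Qed.

(** The set where [|f|] is maximal on a closed disc is compact; its points of
    largest modulus cannot be interior since [f] is constant near interior
    maxima. *)
Lemma max_principle f r M : 0 < r < 1 ->
  (forall c, disc c -> analytic_at f c) ->
  (forall z, normc z = r -> normc (f z) <= M) ->
  forall z, normc z <= r -> normc (f z) <= M.
Proof.
move=> /andP[r0 r1] fA fM z0 z0r.
pose K := [set z : R[i] | normc z <= r].
have K0 : K 0 by rewrite /K /mkset ComplexField.Normc.normc0 ltW.
have [||c] := @compact_EVT_max _ _ (fun z => normc (f z)) K _ (@compact_closed_disc r).
- by exists 0.
- exact: analytic_within.
rewrite inE => cK cmax.
pose Z := K `&` [set z | normc (f z) = normc (f c)].
have cZ : compact Z.
  apply: (@subclosed_compact _ _ K) => //; last 2 first.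
  - exact: compact_closed_disc.
  - by move=> z [].
  rewrite closure_id; apply/seteqP; split; first exact: subset_closure.
  move=> z zZ.
  have zK : K z.
    rewrite /K /= leNgt; apply/negP => zr.
    have [|w [[+ _]]] := zZ [set w | normc (w - z) < normc z - r].
      by apply/nbhscP; exists (normc z - r); rewrite ?subr_gt0.
    rewrite /K /= normcB => wr wz.
    have := le_normcD (z - w) w; rewrite subrK; lra.
  split=> //=; apply/eqP; rewrite -subr_eq0 -normr_le0; apply/ler_addgt0Pr => e e0.
  have /fA/analytic_continuous/(_ _ e0)[d d0 dP] : disc z.
    by apply/discP; exact: le_lt_trans zK r1.
  have [|w [[_ /= wc]]] := zZ [set w | normc (w - z) < d].
    by apply/nbhscP; exists d.
  move=> /dP wz; rewrite add0r -wc ltW// (le_lt_trans _ wz)// distrC ler_norml.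
  apply/andP; split.
    by rewrite lerNl opprB lerBlDr normcB (le_trans _ (le_normcD _ _))// subrK.
  by rewrite lerBlDr (le_trans _ (le_normcD _ _))// subrK.
have [||m] := @compact_EVT_max _ _ (@normc R) Z _ cZ.
- by exists c.
- by apply: continuous_subspaceT; exact: normc_continuous.
rewrite inE => -[mK mc] mmax.
rewrite (le_trans (cmax z0 _)) ?inE// -mc; apply: fM; apply/eqP.
rewrite eq_le mK/= leNgt; apply/negP => mr.
have md : disc m by apply/discP; exact: lt_trans mr r1.
have [||e e0 eP] := @local_max_const f m (r - normc m) (fA _ md).
- by rewrite subr_gt0.
- move=> z zm; rewrite mc; apply: cmax; rewrite inE /K /=.
  have := le_normcD (z - m) m; rewrite subrK; lra.
(* A point further out than [m], at which [|f|] is still maximal. *)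
pose h := Num.min (e / 2) ((r - normc m) / 2).
have h0 : 0 < h by rewrite lt_min !divr_gt0//= subr_gt0.
have he : h <= e / 2 by rewrite ge_min lexx.
have hr : h <= (r - normc m) / 2 by rewrite ge_min lexx orbT.
pose u : R[i] := if m == 0 then 1 else m / (normc m)%:C%C.
have u1 : normc u = 1.
  rewrite /u; case: eqVneq => [_|m0]; first exact: ComplexField.Normc.normc1.
  rewrite ComplexField.Normc.normcM ComplexField.Normc.normcV normc_real.
  by rewrite ger0_norm ?normc_ge0// divff// normc_eq0.
have mu : m = (normc m)%:C%C * u.
  rewrite /u; case: eqVneq => [->|m0].
    by rewrite ComplexField.Normc.normc0 mul0r.
  by rewrite mulrCA divff ?mulr1// fmorph_eq0 normc_eq0.
have nw : normc (m + h%:C%C * u) = normc m + h.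
  rewrite {1}mu -mulrDl -rmorphD ComplexField.Normc.normcM u1 mulr1 normc_real.
  by rewrite ger0_norm// addr_ge0 ?normc_ge0// ltW.
have := mmax (m + h%:C%C * u); rewrite nw inE => H.
suff : Z (m + h%:C%C * u) by move=> /H; lra.
split; first by rewrite /K /= nw; lra.
rewrite /= -mc eP// addrC addKr ComplexField.Normc.normcM u1 mulr1 normc_real.
by rewrite gtr0_norm//; lra.
Qed.

End MaxPrinciple.

(** * Taylor's theorem on the disc *)

Section Taylor.
Variable R : realType.
Implicit Types (a b : nat -> R[i]) (z c w : R[i]) (f g : R[i] -> R[i]).

Lemma geo_small (M q e : R) : 0 <= q < 1 -> 0 < e ->
  exists n0, forall n, (n0 <= n)%N -> M * q ^+ n < e.
Proof.
move=> /andP[q0 q1] e0.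
have : geometric M q @ \oo --> 0 by apply: cvg_geometric; rewrite ger0_norm.
move=> /cvgrPdist_lt /(_ _ e0)[n0 _ n0P]; exists n0 => n /n0P /=.
by rewrite sub0r normrN; apply: le_lt_trans; exact: ler_norm.
Qed.

(** Iterating the division by [z] produces the Taylor coefficients as the
    values at the origin of the successive quotients [g_k]. *)
Lemma taylor_remainders f : (forall c, disc c -> analytic_at f c) ->
  exists a : nat -> R[i], exists2 g : nat -> R[i] -> R[i],
    (forall k c, disc c -> analytic_at (g k) c) &
    (forall k, g k 0 = a k) /\ forall k z, f z = psum a k z + z ^+ k * g k z.
Proof.
move=> fA.
have [F FP] : {F : (R[i] -> R[i]) -> R[i] -> R[i] & forall f,
    (forall c, disc c -> analytic_at f c) ->
    (forall c, disc c -> analytic_at (F f) c) /\ forall z, f z = f 0 + z * F f z}.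
  apply: (@choice _ _ (fun f h => (forall c, disc c -> analytic_at f c) ->
    (forall c, disc c -> analytic_at h c) /\ forall z, f z = f 0 + z * h z)) => h.
  have [hA|nA] := pselect (forall c, disc c -> analytic_at h c); last by exists h.
  by have [g gA hg] := analytic_div hA; exists g.
pose g k := iter k F f.
have gA k : forall c, disc c -> analytic_at (g k) c.
  by elim: k => [|k IH]; [exact: fA|exact: (FP _ IH).1].
exists (fun k => g k 0); exists g; first exact: gA.
split=> // k z; elim: k => [|k IH].
  by rewrite /psum big_geq// expr0 mul1r add0r.
rewrite IH (FP _ (gA k)).2 mulrDr addrA /psum big_nat_recr//=.
by rewrite [z ^+ k * g k 0]mulrC exprSr mulrA.
Qed.

(** Averaging [w ^ m f (w ^ m z)] over the [(k+1)]-th roots of unity [w]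
    kills the terms of degree less than [k] and leaves [z ^ k G z] with
    [G 0] the [k]-th coefficient, so that the maximum principle for [G] gives
    Cauchy's estimate. *)
Lemma cauchy_estimate f a (g : nat -> R[i] -> R[i]) (r M : R) k :
  0 < r < 1 ->
  (forall k c, disc c -> analytic_at (g k) c) ->
  (forall k, g k 0 = a k) ->
  (forall k z, f z = psum a k z + z ^+ k * g k z) ->
  (forall z, normc z = r -> normc (f z) <= M) ->
  normc (a k) * r ^+ k <= M.
Proof.
move=> r01 gA ga fg fM; have /andP[r0 r1] := r01.
(* Because [w ^ (k + 1) = 1], the factor [w ^ m] plays the part of [w ^ (- k m)]. *)
pose w : R[i] := expi (2 * pi / k.+1%:R).
have w1 : normc w = 1 by exact: normc_expi.
have wk : w ^+ k.+1 = 1 by rewrite expiX mulrC divfK ?pnatr_eq0// expi2pi.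
pose F z := \sum_(m < k.+1) w ^+ m * f (w ^+ m * z).
pose G z := \sum_(m < k.+1) g k (w ^+ m * z).
have FG z : F z = z ^+ k * G z.
  rewrite /F (eq_bigr (fun m : 'I_k.+1 => w ^+ m * psum a k (w ^+ m * z) +
      z ^+ k * g k (w ^+ m * z))).
    rewrite big_split /= -mulr_sumr [X in X + _](_ : _ = 0) ?add0r//.
    rewrite /psum (eq_bigr (fun m : 'I_k.+1 => \sum_(0 <= i < k)
       a i * z ^+ i * w ^+ (i.+1 * m))); last first.
      move=> m _; rewrite mulr_sumr; apply: eq_bigr => i _.
      by rewrite exprMn mulnC exprM exprSr; ring.
    rewrite exchange_big /= big_nat_cond big1// => i; rewrite andbT => /andP[_ ik].
    by rewrite -mulr_sumr sum_root_unity ?mulr0// ltnS ik.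
  move=> m _; rewrite (fg k) mulrDr; congr (_ + _).
  by rewrite exprMn !mulrA -exprS exprAC wk expr1n mul1r.
have GA c : disc c -> analytic_at G c.
  move=> cd; apply: (@analytic_sum _ (fun m z => g k (w ^+ m * z))) => m.
  have /(gA k)[b [s [N gb]]] : disc (w ^+ m * c).
    apply/discP; rewrite ComplexField.Normc.normcM normcX w1 expr1n mul1r.
    exact/discP.
  exists (fun j => b j * (w ^+ m) ^+ j), s, N.
  by apply: expansion_rot => //; rewrite normcX w1 expr1n.
have G0 : G 0 = k.+1%:R * a k.
  rewrite /G (eq_bigr (fun=> a k)) => [|m _]; last by rewrite mulr0 ga.
  by rewrite sumr_const card_ord mulr_natl.
have GM z : normc z = r -> normc (G z) <= k.+1%:R * M / r ^+ k.
  move=> zr; rewrite ler_pdivlMr ?exprn_gt0// mulrC -zr -normcX.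
  rewrite -ComplexField.Normc.normcM -FG (le_trans (normc_sum _ _ _))//.
  rewrite (@le_trans _ _ (\sum_(m < k.+1) M))//; last first.
    by rewrite sumr_const card_ord mulr_natl.
  apply: ler_sum => m _; rewrite ComplexField.Normc.normcM normcX w1 expr1n mul1r.
  by apply: fM; rewrite ComplexField.Normc.normcM normcX w1 expr1n mul1r.
have := @max_principle _ G r _ r01 GA GM 0.
rewrite ComplexField.Normc.normc0 => /(_ (ltW r0)).
rewrite G0 ComplexField.Normc.normcM ler_pdivlMr ?exprn_gt0//.
have -> : normc (k.+1%:R : R[i]) = k.+1%:R.
  by rewrite -(rmorph_nat (real_complex R)) normc_real ger0_norm.
by rewrite -mulrA ler_pM2l// ltr0n.
Qed.

Lemma bounded_circle f r : 0 < r < 1 -> (forall c, disc c -> analytic_at f c) ->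
  exists2 M, 0 <= M & forall z, normc z = r -> normc (f z) <= M.
Proof.
move=> /andP[r0 r1] fA.
have [||c _ cmax] := @compact_EVT_max _ _ (fun z => normc (f z)) _ _ (@compact_closed_disc R r).
- by exists 0; rewrite /mkset ComplexField.Normc.normc0 ltW.
- exact: analytic_within.
exists (normc (f c)) => [|z zr]; first exact: normc_ge0.
by apply: cmax; rewrite inE /mkset zr.
Qed.

(** On the circle of radius [r] the remainder [z ^ k g_k = f - psum a k] is
    bounded independently of [k], by Cauchy's estimates on a larger circle; the
    maximum principle for [g_k] then makes it [O ((|z| / r) ^ k)] inside. *)
Lemma taylor f : analytic_disc f -> exists a, sums a f.
Proof.
move=> /analytic_discP fA.
have [a [g gA [ga fg]]] := taylor_remainders fA.
exists a => z /discP z1; have z0 := normc_ge0 z.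
pose r := (1 + normc z) / 2; pose s := (1 + r) / 2.
have r0 : 0 < r by rewrite /r; lra.
have r1 : r < 1 by rewrite /r; lra.
have zr : normc z < r by rewrite /r; lra.
have s0 : 0 < s by rewrite /s; lra.
have s1 : s < 1 by rewrite /s; lra.
have rs : r < s by rewrite /s; lra.
have [|M M0 fM] := @bounded_circle f r _ fA; first by rewrite r0.
have [|N N0 fN] := @bounded_circle f s _ fA; first by rewrite s0.
have aN k : normc (a k) * s ^+ k <= N.
  by apply: (@cauchy_estimate f a g s N k _ gA ga fg fN); rewrite s0.
have q01 : 0 <= r / s < 1 by rewrite divr_ge0 ?(ltW r0) ?(ltW s0)//= ltr_pdivrMr// mul1r.
pose C := M + N / (1 - r / s).
have gC k w : normc w = r -> normc (g k w) <= C / r ^+ k.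
  move=> wr; rewrite ler_pdivlMr ?exprn_gt0// mulrC -wr -normcX.
  rewrite -ComplexField.Normc.normcM.
  have -> : w ^+ k * g k w = f w - psum a k w by rewrite (fg k) addrC addKr.
  rewrite (le_trans (le_normcD _ _))// normcN lerD ?fM//.
  rewrite (le_trans (normc_sum _ _ _))//.
  rewrite (@le_trans _ _ (\sum_(0 <= i < 0 + k) N * (r / s) ^+ i))//.
    apply: ler_sum => i _; rewrite ComplexField.Normc.normcM normcX wr.
    rewrite (_ : N * (r / s) ^+ i = N * r ^+ i / s ^+ i); last by rewrite expr_div_n mulrA.
    by rewrite ler_pdivlMr ?exprn_gt0// mulrAC ler_wpM2r ?exprn_ge0 ?(ltW r0).
  by rewrite -mulr_sumr ler_wpM2l// (le_trans (geo_sum_le _ _ q01))// expr0 mul1r.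
have p01 : 0 <= normc z / r < 1 by rewrite divr_ge0 ?(ltW r0)//= ltr_pdivrMr// mul1r.
apply/cvgcP => e e0; have [n0 n0P] := geo_small C p01 e0.
exists n0 => n /n0P; apply: le_lt_trans.
rewrite (fg n) opprD addrA subrr add0r normcN ComplexField.Normc.normcM normcX.
have r01 : 0 < r < 1 by rewrite r0.
have := @max_principle _ (g n) r _ r01 (gA n) (gC n) z (ltW zr).
rewrite (_ : C * (normc z / r) ^+ n = normc z ^+ n * (C / r ^+ n)).
  by move=> h; rewrite ler_wpM2l ?exprn_ge0.
by rewrite expr_div_n mulrCA.
Qed.

End Taylor.

(** * Power series are analytic on the disc *)

Section Reexpansion.
Variable R : realType.
Implicit Types (a b : nat -> R[i]) (z c w : R[i]) (f g : R[i] -> R[i]).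

(** The quotient by [z - c] has coefficients
    [\sum_(j > i) a_j c ^ (j - i - 1)], at the price of
    dividing the geometric bound by [r - |c|]. *)
Lemma psum_div c (r : R) : normc c < r -> forall a, exists p : (nat -> R[i]) * R[i],
  forall M, (forall k, normc (a k) * r ^+ k <= M) ->
  [/\ forall k, normc (p.1 k) * r ^+ k <= M / (r - normc c),
   normc p.2 <= M * r / (r - normc c) &
   forall z l, normc z < r -> psum p.1 ^~ z @ \oo --> l ->
     psum a ^~ z @ \oo --> p.2 + (z - c) * l].
Proof.
move=> cr a; have c0 := normc_ge0 c.
have r0 : 0 < r by exact: le_lt_trans cr.
have cr01 : 0 <= normc c < r by rewrite c0.
have d0 : 0 < r - normc c by rewrite subr_gt0.
have [[M aM]|nM] := pselect (exists M, forall k, normc (a k) * r ^+ k <= M); last first.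
  by exists (fun=> 0, 0) => M aM; case: nM; exists M.
have tailM N i : (forall k, normc (a k) * r ^+ k <= N) ->
    forall k, normc (a (i + k)%N) * r ^+ k <= N / r ^+ i.
  move=> aN k; rewrite ler_pdivlMr ?exprn_gt0// -mulrA -exprD addnC [(k + i)%N]addnC.
  by rewrite addnC.
have : forall i, exists l : R[i], psum (fun j => a (i + j)%N) ^~ c @ \oo --> l.
  by move=> i; have [l ? _] := psum_geo cr01 (tailM M i aM) (lexx _); exists l.
move=> /choice[S SP].
have S_rec i : S i = a i + c * S i.+1.
  apply: cvgc_unique (cvgcS (SP i)) _.
  under eq_fun do rewrite psumS addn0.
  apply: cvgcD; first exact: cvgc_cst.
  apply: cvgcM; rewrite (_ : (fun k => a (i + k.+1)%N) = fun k => a (i.+1 + k)%N).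
    exact: SP.
  by apply/funext => k; rewrite addnS addSn.
have S_le N i : (forall k, normc (a k) * r ^+ k <= N) ->
    normc (S i) <= N * r / (r - normc c) / r ^+ i.
  move=> aN; have := psum_tail 0 cr01 (tailM N i aN) (lexx _) (SP i).
  rewrite {1}/psum big_geq// sub0r normcN expr0 mulr1.
  suff -> : N / r ^+ i / (1 - normc c / r) = N * r / (r - normc c) / r ^+ i by [].
  by field; rewrite !gt_eqF ?exprn_gt0.
exists (fun i => S i.+1, S 0%N) => N aN; split=> /= [k||z l zr pl].
- rewrite (le_trans (ler_wpM2r _ (S_le _ _ aN)))//; first by rewrite exprn_ge0// ltW.
  rewrite le_eqVlt; apply/orP; left; apply/eqP; rewrite exprS.
  by field; rewrite !gt_eqF ?exprn_gt0.
- by have := S_le _ 0%N aN; rewrite expr0 divr1.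
have pa n : psum a n z = S 0%N + (z - c) * psum (fun i => S i.+1) n z - S n * z ^+ n.
  elim: n => [|n IH].
    by rewrite /psum !big_geq// mulr0 addr0 expr0 mulr1 subrr.
  rewrite /psum !big_nat_recr//= -/(psum _ _ _) -/(psum _ _ _) IH.
  have -> : a n = S n - c * S n.+1 by rewrite (S_rec n) addrK.
  by rewrite exprS; ring.
rewrite (funext pa) -[_ + _ * l]addr0; apply: cvgcD.
  by apply: cvgcD; [exact: cvgc_cst|exact: cvgcM].
have q01 : 0 <= normc z / r < 1.
  by rewrite divr_ge0 ?normc_ge0 ?(ltW r0)//= ltr_pdivrMr// mul1r.
apply/cvgcP => e e0.
have [n0 n0P] := geo_small (N * r / (r - normc c)) q01 e0.
exists n0 => n /n0P; apply: le_lt_trans; rewrite subr0 normcN.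
rewrite ComplexField.Normc.normcM normcX expr_div_n.
rewrite [_ * (_ / _)]mulrCA [leRHS]mulrC ler_wpM2r ?exprn_ge0 ?normc_ge0//.
exact: S_le.
Qed.

(** Iterated division by [z - c] yields the coefficients at [c]; as each step
    divides the bound by [r - |c|], the new series converges with that radius. *)
Lemma sums_analytic a f : sums a f -> analytic_disc f.
Proof.
move=> af; apply/analytic_discP => c /discP c1; have c0 := normc_ge0 c.
pose r := (1 + normc c) / 2.
have r0 : 0 < r by rewrite /r; lra.
have r1 : r < 1 by rewrite /r; lra.
have cr : normc c < r by rewrite /r; lra.
have [|M M0 aM] := sums_tame af (r := r); first by rewrite r0.
have [p pP] := choice (psum_div cr).
pose A K := iter K (fun a => (p a).1) a; pose b K := (p (A K)).2.
pose d := r - normc c; have d0 : 0 < d by rewrite subr_gt0.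
have AM K : forall k, normc (A K k) * r ^+ k <= M / d ^+ K.
  elim: K => [|K IH]; first by rewrite expr0 divr1.
  have [h _ _] := pP _ _ IH; move=> k; rewrite (le_trans (h k))//.
  by rewrite exprSr invfM mulrA.
have Ab K z l : normc z < r -> psum (A K) ^~ z @ \oo --> l ->
    psum a ^~ z @ \oo --> psum b K (z - c) + (z - c) ^+ K * l.
  move=> zr; elim: K l => [|K IH] l.
    rewrite [psum b 0%N _]/psum big_geq; last exact: leqnn.
    by rewrite add0r expr0 mul1r => h; exact: h.
  have [_ _ h] := pP _ _ (AM K); move=> /(h _ _ zr)/IH.
  rewrite [psum b K.+1 _]/psum big_nat_recr; last exact: leq0n.
  rewrite -/(psum b K (z - c)) -/(b K) exprSr mulrDr addrA mulrA [(z - c) ^+ K * b K]mulrC.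
  by move=> {}h; exact: h.
exists b, d, (M * r / d); split=> [|K|z zd]; first exact: d0.
  have [_ h _] := pP _ _ (AM K); rewrite (le_trans (ler_wpM2r _ h))//.
    by rewrite exprn_ge0// ltW.
  rewrite le_eqVlt; apply/orP; left; apply/eqP.
  by rewrite -/d; field; rewrite !gt_eqF ?exprn_gt0.
have zr : normc z < r.
  by have := le_normcD (z - c) c; rewrite subrK; rewrite /d in zd; lra.
have zdisc : disc z by apply/discP; exact: lt_trans zr r1.
have zr01 : 0 <= normc z < r by rewrite normc_ge0.
have q01 : 0 <= normc (z - c) / d < 1.
  by rewrite divr_ge0 ?normc_ge0 ?(ltW d0)//= ltr_pdivrMr// mul1r.
apply/cvgcP => e e0.
have [n0 n0P] := geo_small (M / (1 - normc z / r)) q01 e0.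
exists n0 => n /n0P; apply: le_lt_trans.
have [l Al _] := psum_geo zr01 (AM n) (lexx _).
have := psum_tail 0 zr01 (AM n) (lexx _) Al.
rewrite {1}/psum big_geq// sub0r normcN expr0 mulr1 => lM.
rewrite (cvgc_unique (af _ zdisc) (Ab _ _ _ zr Al)) opprD addrA subrr add0r normcN.
rewrite ComplexField.Normc.normcM normcX expr_div_n.
rewrite [leRHS]mulrCA ler_wpM2l ?exprn_ge0 ?normc_ge0//.
by rewrite (le_trans lM)// mulrAC.
Qed.

End Reexpansion.

(** * Means over the circle *)

Section CircleMean.
Variable R : realType.
Implicit Types (g h : R -> R) (x y t : R).

Definition circ g : R := (2 * pi)^-1 * \int[lebesgue_measure]_(t in `[0, 2 * pi]) g t.

Let pi2 : 0 < 2 * pi :> R.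
Proof. by rewrite mulr_gt0// pi_gt0. Qed.

Lemma circ_integrable g : continuous g ->
  (@lebesgue_measure R).-integrable `[0, 2 * pi] (EFin \o g).
Proof.
move=> cg; apply: continuous_compact_integrable; first exact: segment_compact.
exact: continuous_subspaceT.
Qed.

Lemma circD g h : continuous g -> continuous h ->
  circ (fun t => g t + h t) = circ g + circ h.
Proof.
move=> cg ch; rewrite /circ RintegralD; [exact: mulrDr|exact: measurable_itv| |];
  exact: circ_integrable.
Qed.

Lemma circZ x g : continuous g -> circ (fun t => x * g t) = x * circ g.
Proof.
move=> cg; rewrite /circ RintegralZl; [exact: mulrCA|exact: measurable_itv|].
exact: circ_integrable.
Qed.

Lemma circ_cst x : circ (fun=> x) = x.
Proof.
rewrite /circ Rintegral_cst//= lebesgue_measure_itv/= lte_fin pi2 sube0 /=.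
by rewrite mulrCA mulVf ?mulr1// gt_eqF.
Qed.

Lemma le_circ g h : continuous g -> continuous h -> (forall t, g t <= h t) ->
  circ g <= circ h.
Proof.
move=> cg ch gh; rewrite /circ ler_wpM2l ?invr_ge0 ?(ltW pi2)//.
by apply: le_Rintegral => //; exact: circ_integrable.
Qed.

Lemma continuous_sumr (I : Type) (s : seq I) (F : I -> R -> R) :
  (forall i, continuous (F i)) -> continuous (fun t => \sum_(i <- s) F i t).
Proof.
move=> cF; elim: s => [|i s IH].
  by under eq_fun do rewrite big_nil; exact: cst_continuous.
under eq_fun do rewrite big_cons.
by move=> t; apply: cvgD; [exact: cF|exact: IH].
Qed.

Lemma circ_sum (I : Type) (s : seq I) (F : I -> R -> R) :
  (forall i, continuous (F i)) ->
  circ (fun t => \sum_(i <- s) F i t) = \sum_(i <- s) circ (F i).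
Proof.
move=> cF; elim: s => [|i s IH].
  by under eq_fun do rewrite big_nil; rewrite circ_cst big_nil.
under eq_fun do rewrite big_cons.
by rewrite circD ?IH ?big_cons//; exact: continuous_sumr.
Qed.

Lemma continuous_cosM x : continuous (fun t => cos (x * t)).
Proof.
move=> t; apply: (@continuous_comp _ _ _ (fun t => x * t) cos).
  exact: mulrl_continuous.
exact: continuous_cos.
Qed.

Lemma continuous_sinM x : continuous (fun t => sin (x * t)).
Proof.
move=> t; apply: (@continuous_comp _ _ _ (fun t => x * t) sin).
  exact: mulrl_continuous.
exact: continuous_sin.
Qed.

Lemma circ_FTC (F g : R -> R) : continuous g ->
  (forall t, is_derive t 1 F (g t)) -> circ g = (2 * pi)^-1 * (F (2 * pi) - F 0).
Proof.
move=> cg Fg; rewrite /circ /Rintegral (@continuous_FTC2 _ g F 0 (2 * pi))//.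
- exact: continuous_subspaceT.
- have cF t : F @ t --> F t.
    by apply/differentiable_continuous/derivable1_diffP; have [] := Fg t.
  split; [by move=> t _; have [] := Fg t|exact: cvg_at_right_filter|exact: cvg_at_left_filter].
- by move=> t _; rewrite derive1E; apply: derive_val.
Qed.

Lemma is_derive_comp_mul (f : R -> R) (x d t : R) : is_derive (x * t) 1 f d ->
  is_derive t 1 (fun s => f (x * s)) (x * d).
Proof.
move=> fd; have h : is_derive t (1 : R) (fun s : R => x * s) x.
  have := @is_deriveZ _ _ _ id x t 1 1 (is_derive_id t 1).
  by rewrite /GRing.scale /= mulr1.
by rewrite mulrC; exact: (is_derive1_comp fd h).
Qed.

Lemma circ_cos m : circ (fun t => cos (m%:R * t)) = (m == 0%N)%:R.
Proof.
case: m => [|m].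
  by under eq_fun do rewrite mul0r cos0; exact: circ_cst.
have m0 : m.+1%:R != 0 :> R by rewrite pnatr_eq0.
apply: (mulfI m0); rewrite -circZ; last exact: continuous_cosM.
have h t : is_derive t (1 : R) (fun s => sin (m.+1%:R * s)) (m.+1%:R * cos (m.+1%:R * t)).
  by apply: is_derive_comp_mul; exact: is_derive_sin.
rewrite (circ_FTC _ h).
- have := expiX (2 * pi : R) m.+1; rewrite expi2pi expr1n => -[_ <-].
  by rewrite mulr0 sin0 subrr !mulr0.
- by move=> t; apply: cvgM; [exact: cvg_cst|exact: continuous_cosM].
Qed.

Lemma circ_sin m : circ (fun t => sin (m%:R * t)) = 0.
Proof.
case: m => [|m].
  by under eq_fun do rewrite mul0r sin0; exact: circ_cst.
have m0 : - m.+1%:R != 0 :> R by rewrite oppr_eq0 pnatr_eq0.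
apply: (mulfI m0); rewrite -circZ; last exact: continuous_sinM.
have h t : is_derive t (1 : R) (fun s => cos (m.+1%:R * s)) (- m.+1%:R * sin (m.+1%:R * t)).
  by rewrite mulNr -mulrN; apply: is_derive_comp_mul; exact: is_derive_cos.
rewrite (circ_FTC _ h).
- have := expiX (2 * pi : R) m.+1; rewrite expi2pi expr1n => -[<- _].
  by rewrite mulr0 cos0 subrr !mulr0.
- by move=> t; apply: cvgM; [exact: cvg_cst|exact: continuous_sinM].
Qed.

(** The real part of the orthogonality of the characters [exp (i n t)]; the
    imaginary part is [circ_sinB]. *)
Lemma circ_cosB m n :
  circ (fun t => cos (m%:R * t) * cos (n%:R * t) + sin (m%:R * t) * sin (n%:R * t))
  = (m == n)%:R.
Proof.
under eq_fun do rewrite -cosB -mulrBl.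
have [mn|nm] := leqP n m.
  rewrite -natrB// circ_cos subn_eq0; congr (nat_of_bool _)%:R.
  by rewrite eqn_leq mn andbT.
under eq_fun do rewrite -cosN -mulNr opprB -natrB ?(ltnW nm)//.
rewrite circ_cos subn_eq0; congr (nat_of_bool _)%:R.
by rewrite leqNgt nm ltn_eqF.
Qed.

Lemma circ_sinB m n :
  circ (fun t => sin (m%:R * t) * cos (n%:R * t) - cos (m%:R * t) * sin (n%:R * t)) = 0.
Proof.
under eq_fun do rewrite -sinB -mulrBl.
have [mn|nm] := leqP n m; first by rewrite -natrB// circ_sin.
under eq_fun do rewrite -[_ * _]opprK sinN -mulNr opprB -natrB ?(ltnW nm)// -mulN1r.
by rewrite circZ ?circ_sin ?mulr0//; exact: continuous_sinM.
Qed.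

End CircleMean.

(** * Circle means of power series *)

Section M1.
Variable R : realType.
Implicit Types (a b : nat -> R[i]) (z c w : R[i]) (f g : R[i] -> R[i]).

Lemma M1E f (r : R) : M1 f r = circ (fun t => normc (f (r%:C%C * expi t))).
Proof. by []. Qed.

Lemma normc_circle (r t : R) : 0 <= r -> normc (r%:C%C * expi t) = r.
Proof.
by move=> r0; rewrite ComplexField.Normc.normcM normc_expi normc_real mulr1 ger0_norm.
Qed.

Lemma continuous_circle f (r : R) : 0 < r < 1 -> analytic_disc f ->
  continuous (fun t : R => normc (f (r%:C%C * expi t))).
Proof.
move=> /andP[r0 r1] /analytic_discP fA t.
apply: (@continuous_comp _ _ _ (fun t => f (r%:C%C * expi t)) (@normc R)); last first.
  exact: normc_continuous.
have /fA/analytic_continuous fc : disc (r%:C%C * expi t).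
  by apply/discP; rewrite normc_circle ?(ltW r0).
move=> A /nbhscP[e /fc[d d0 dP] sub].
have d2 : 0 < d / 2 by rewrite divr_gt0.
have /cvgrPdist_lt/(_ _ d2) cd := @continuous_cos R t.
have /cvgrPdist_lt/(_ _ d2) sd := @continuous_sin R t.
suff : \forall s \near t, A (f (r%:C%C * expi s)) by [].
near=> s.
suff : normc (r%:C%C * expi s - r%:C%C * expi t) < d by move=> /dP/sub.
rewrite -mulrBr ComplexField.Normc.normcM normc_real gtr0_norm//.
have sc : normc (expi s - expi t) < d.
  rewrite (le_lt_trans (normc_le_ReIm _))//= [ltRHS]splitr ltrD//.
    by rewrite distrC; near: s.
  by rewrite distrC; near: s.
by rewrite (le_lt_trans _ sc)// ler_piMl ?normc_ge0// ltW.
Unshelve. all: end_near. Qed.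

(** Uniform approximation on the circle of radius [r] passes to the means, so
    that estimates for [M1] can be made on partial sums. *)
Lemma M1_close f g (r e : R) : 0 < r < 1 -> analytic_disc f -> analytic_disc g ->
  (forall z, normc z = r -> normc (f z - g z) <= e) -> M1 f r <= M1 g r + e.
Proof.
move=> r01 fA gA fg; rewrite !M1E -[X in _ + X]circ_cst -circD; last first.
- exact: cst_continuous.
- exact: continuous_circle.
apply: le_circ => [||t].
- exact: continuous_circle.
- by move=> t; apply: cvgD; [exact: continuous_circle|exact: cvg_cst].
have r0 : 0 <= r by case/andP: r01 => /ltW.
have /fg h := normc_circle t r0.
by rewrite -{1}(subrK (g (r%:C%C * expi t)) (f _)) (le_trans (le_normcD _ _))// addrC lerD2l.
Qed.

Lemma psum_sums a K : sums (fun k => if (k < K)%N then a k else 0) (psum a K).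
Proof.
move=> z _; apply/cvgcP => e e0; exists K => n Kn.
suff -> : psum (fun k => if (k < K)%N then a k else 0) n z = psum a K z.
  by rewrite subrr ComplexField.Normc.normc0.
rewrite /psum (big_cat_nat (n := K))//= [X in _ + X]big_nat_cond [X in _ + X]big1 ?addr0.
  by apply: eq_big_nat => k /andP[_ ->].
by move=> k; rewrite andbT => /andP[Kk _]; rewrite ltnNge Kk mul0r.
Qed.

Lemma psum_analytic a K : analytic_disc (psum a K).
Proof. exact: (sums_analytic (@psum_sums a K)). Qed.

Lemma M1_sum (I : Type) (s : seq I) (F : I -> R[i] -> R[i]) (r : R) : 0 < r < 1 ->
  (forall i, analytic_disc (F i)) -> analytic_disc (fun z => \sum_(i <- s) F i z) ->
  M1 (fun z => \sum_(i <- s) F i z) r <= \sum_(i <- s) M1 (F i) r.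
Proof.
move=> r01 FA sA; rewrite M1E.
rewrite (eq_bigr _ (fun i _ => M1E (F i) r)).
rewrite -(@circ_sum _ _ _ (fun i t => normc (F i (r%:C%C * expi t)))); last first.
  by move=> i; exact: (continuous_circle r01 (FA i)).
apply: le_circ => [||t]; last exact: normc_sum.
- exact: (@continuous_circle (fun z => \sum_(i <- s) F i z) _ r01 sA).
- by apply: continuous_sumr => i; exact: (continuous_circle r01 (FA i)).
Qed.

(** The mean of the real part of [u exp (- i n t) psum a K], where [u] is
    unimodular and [u a_n = |a_n|], is exactly [|a_n| r ^ n]. *)
Lemma psum_coef_le_M1 a K n (r : R) : 0 < r < 1 -> (n < K)%N ->
  normc (a n) * r ^+ n <= M1 (psum a K) r.
Proof.
move=> r01 nK; have /andP[r0 r1] := r01.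
pose u : R[i] := if a n == 0 then 1 else (normc (a n))%:C%C / a n.
have u1 : normc u = 1.
  rewrite /u; case: eqVneq => [_|an0]; first exact: ComplexField.Normc.normc1.
  rewrite ComplexField.Normc.normcM ComplexField.Normc.normcV normc_real.
  by rewrite ger0_norm ?normc_ge0// divff// normc_eq0.
have ua : u * a n = (normc (a n))%:C%C.
  rewrite /u; case: eqVneq => [->|an0]; last by rewrite divfK.
  by rewrite mulr0 ComplexField.Normc.normc0.
pose C k t : R := cos (k%:R * t) * cos (n%:R * t) + sin (k%:R * t) * sin (n%:R * t).
pose S k t : R := sin (k%:R * t) * cos (n%:R * t) - cos (k%:R * t) * sin (n%:R * t).
have cC k : continuous (C k).
  by move=> t; apply: cvgD; apply: cvgM; (exact: continuous_cosM || exact: continuous_sinM).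
have cS k : continuous (S k).
  by move=> t; apply: cvgB; apply: cvgM; (exact: continuous_cosM || exact: continuous_sinM).
pose G k t := (complex.Re (u * a k) * r ^+ k) * C k t + (- complex.Im (u * a k) * r ^+ k) * S k t.
have cG k : continuous (G k).
  by move=> t; apply: cvgD; (apply: cvgM; first exact: cvg_cst); [exact: cC|exact: cS].
have <- : circ (fun t => \sum_(0 <= k < K) G k t) = normc (a n) * r ^+ n.
  rewrite circ_sum// (bigD1_seq n) ?mem_index_iota ?iota_uniq//=.
  have cGE k : circ (G k) = complex.Re (u * a k) * r ^+ k * (k == n)%:R.
    rewrite circD ?circZ ?circ_cosB ?circ_sinB ?mulr0 ?addr0//.
    - by move=> t; apply: cvgM; [exact: cvg_cst|exact: cC].
    - by move=> t; apply: cvgM; [exact: cvg_cst|exact: cS].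
  rewrite cGE eqxx mulr1 ua big1 ?addr0// => k /negPf kn.
  by rewrite cGE kn mulr0.
rewrite M1E; apply: le_circ => [||t].
- exact: continuous_sumr.
- exact: (continuous_circle r01 (psum_analytic a K)).
pose v := u * (cos (n%:R * t) -i* sin (n%:R * t))%C.
have v1 : normc v = 1.
  rewrite ComplexField.Normc.normcM u1 mul1r /= sqrrN cos2Dsin2 sqrtr1//.
rewrite -[leRHS]mul1r -v1 -ComplexField.Normc.normcM.
suff -> : \sum_(0 <= k < K) G k t = complex.Re (v * psum a K (r%:C%C * expi t)).
  by rewrite (le_trans (ler_norm _))// normc_Re.
rewrite /psum mulr_sumr Re_sum; apply: eq_bigr => k _.
have -> : v * (a k * (r%:C%C * expi t) ^+ k) =
    (u * a k) * (r ^+ k)%:C%C * ((cos (n%:R * t) -i* sin (n%:R * t))%C * expi t ^+ k).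
  by rewrite exprMn -rmorphXn /= /v; ring.
rewrite expiX /expi /G /C /S; case: (u * a k) => x y /=; ring.
Qed.

Lemma coef_le_M1 a f n (r : R) : 0 < r < 1 -> sums a f ->
  normc (a n) * r ^+ n <= M1 f r.
Proof.
move=> r01 af; have /andP[r0 r1] := r01.
apply/ler_addgt0Pr => e e0.
pose s := (1 + r) / 2.
have s01 : 0 < s < 1 by rewrite /s; lra.
have rs01 : 0 <= r < s by rewrite /s; lra.
have [M M0 aM] := sums_tame af s01.
have q01 : 0 <= r / s < 1.
  case/andP: s01 => s0 _.
  by rewrite divr_ge0 ?(ltW r0) ?(ltW s0)//= ltr_pdivrMr// mul1r; lra.
have [n0 n0P] := geo_small (M / (1 - r / s)) q01 e0.
pose K := maxn n0 n.+1.
apply: le_trans (psum_coef_le_M1 _ r01 (leq_maxr n0 n.+1)) _.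
apply: M1_close => //; [exact: psum_analytic|exact: sums_analytic af|].
move=> z zr; have zd : disc z by apply/discP; rewrite zr.
rewrite (le_trans (psum_tail _ rs01 aM _ (af _ zd))) ?zr//.
by rewrite mulrAC ltW// n0P// leq_maxl.
Qed.

(** The coefficients of the difference are dominated by the circle means of
    zero. *)
Lemma sums_unique a b f : sums a f -> sums b f -> a = b.
Proof.
move=> af bf; apply/funext => n; apply/eqP; rewrite -subr_eq0 -normc_eq0 eq_le normc_ge0 andbT.
have abf : sums (fun k => a k + -1 * b k) (fun=> 0).
  move=> z zd; rewrite -(subrr (f z)) -[X in _ - X]mul1r -mulNr.
  rewrite (_ : psum _ ^~ z = fun n => psum a n z + -1 * psum b n z).
    by apply: cvgcD; [exact: af|apply: cvgcM; exact: bf].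
  by apply/funext => k; rewrite psumD psumZ.
have h0 : 0 < 1 / 2 :> R by [].
have h01 : 0 < (1 / 2 : R) < 1 by apply/andP; split; lra.
have := coef_le_M1 n h01 abf; rewrite M1E.
under eq_fun do rewrite ComplexField.Normc.normc0.
by rewrite circ_cst mulN1r pmulr_lle0// exprn_gt0.
Qed.

End M1.

(** * Iterates of the weighted Taylor shift *)

Section Shift.
Variables (R : realType) (alpha : R).
Implicit Types (a b : nat -> R[i]) (z c w : R[i]) (f g : R[i] -> R[i]).

(** The product of the weights of indices [k + 1, ..., k + n]; it telescopes. *)
Definition iter_weight n k : R := ((n + k).+1%:R / k.+1%:R) `^ alpha.

Lemma taylor_coef_sums a f : sums a f -> taylor_coef f = a.
Proof.
move=> af; apply: (@sums_unique _ _ _ f) => //.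
exact: (@getPex _ [set b | sums b f] (ex_intro _ a af)).
Qed.

Lemma shift_weight_le n : shift_weight alpha n.+1 <= 2 `^ `|alpha|.
Proof.
rewrite /shift_weight; set x := 1 + _.
have x1 : 1 <= x by rewrite lerDl invr_ge0.
have x2 : x <= 2 by rewrite /x -[2]/(1 + 1) lerD2l invf_le1 ?ler1n// ltr0n.
rewrite (@le_trans _ _ (x `^ `|alpha|)) ?ler_powR ?ler_norm//.
by rewrite ge0_ler_powR ?nnegrE//; lra.
Qed.

Lemma sums_shift a f : sums a f ->
  sums (fun k => a k.+1 * (shift_weight alpha k.+1)%:C%C) (taylor_shift alpha f).
Proof.
move=> af; set b := fun k => _.
have tb : tame b.
  move=> r r01; have [M M0 aM] := sums_tame af r01; have /andP[r0 _] := r01.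
  exists (M / r * 2 `^ `|alpha|) => [|k].
    by rewrite mulr_ge0 ?powR_ge0// divr_ge0// ltW.
  rewrite /b ComplexField.Normc.normcM normc_real ger0_norm ?powR_ge0// mulrAC.
  rewrite ler_pM ?powR_ge0 ?shift_weight_le//.
    by rewrite mulr_ge0 ?normc_ge0 ?exprn_ge0// ltW.
  by rewrite ler_pdivlMr// -mulrA -exprSr.
have [g bg] := tame_sums tb.
move=> z zd; rewrite /taylor_shift (taylor_coef_sums af).
have -> : limn (series (fun k => b k * z ^+ k)) = g z; last exact: bg.
by apply: cvg_lim; [exact: norm_hausdorff|exact: bg].
Qed.

Lemma iter_weight0 k : iter_weight 0 k = 1.
Proof. by rewrite /iter_weight add0n divff ?pnatr_eq0// powR1. Qed.

Lemma iter_weightS n k :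
  iter_weight n k.+1 * shift_weight alpha k.+1 = iter_weight n.+1 k.
Proof.
rewrite /iter_weight /shift_weight -powRM; last 2 first.
- by rewrite divr_ge0.
- by rewrite addr_ge0// invr_ge0.
have -> : 1 + k.+1%:R^-1 = k.+2%:R / k.+1%:R :> R.
  by rewrite -[k.+2]addn1 natrD mulrDl divff ?pnatr_eq0// mul1r.
by rewrite addnS addSn mulrA divfK ?pnatr_eq0.
Qed.

Lemma sums_iter a f n : sums a f ->
  sums (fun k => a (n + k)%N * (iter_weight n k)%:C%C) (iter n (taylor_shift alpha) f).
Proof.
move=> af; elim: n => [|n IH] /=.
  rewrite (_ : (fun k => _) = a)//; apply/funext => k.
  by rewrite iter_weight0 mulr1.
rewrite (_ : (fun k => _) = fun k => a (n + k.+1)%N * (iter_weight n k.+1)%:C%C *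
    (shift_weight alpha k.+1)%:C%C); first exact: (sums_shift IH).
by apply/funext => k; rewrite -mulrA -rmorphM iter_weightS addnS addSn.
Qed.

Lemma sums_at0 a f : sums a f -> f 0 = a 0%N.
Proof.
move=> af; apply: (@cvgc_unique _ (psum a ^~ 0)); last exact: psum_cvg0.
by apply: af; apply/discP; rewrite ComplexField.Normc.normc0.
Qed.

Lemma entourage_normc (e : R) : 0 < e ->
  entourage [set p : R[i] * R[i] | normc (p.1 - p.2) < e].
Proof.
move=> e0; have e0' : 0 < (e%:C%C : R[i]) by rewrite ltcR.
have := entourage_ball (R[i] : pseudoMetricType R[i]) (PosNum e0').
apply: filterS => -[x y] /=.
by rewrite -ball_normE /= normrcE ltcR.
Qed.

Lemma fam_nbhsS {U : choiceType} {V : uniformType} (fam : set U -> Prop)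
    (A : set U) (E : set (V * V)) (g : {family fam, U -> V})
    (P : set {family fam, U -> V}) :
  entourage E -> fam A -> (forall h : U -> V, (forall y, A y -> E (g y, h y)) -> P h) ->
  nbhs g P.
Proof. by move=> entE famA sub; apply: filterS (fam_nbhs g entE famA). Qed.

(** Evaluation at the origin is uniform convergence on a singleton. *)
Lemma open_large0 (M : R) :
  open ([set g | M < normc (g 0)] : set (compact_convergence R)).
Proof.
rewrite openE => g /= Mg.
have e0 : 0 < normc (g 0) - M by rewrite subr_gt0.
apply: (@fam_nbhsS _ _ _ [set 0] _ g _ (entourage_normc e0)).
  split; first exact: compact_set1.
  by move=> _ ->; apply/discP; rewrite ComplexField.Normc.normc0.
move=> k kg0; have /= := kg0 0 erefl.
have := le_normcD (g 0 - k 0) (k 0); rewrite subrK; lra.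
Qed.

Lemma density_gt0_unbounded (A : set nat) : (0 < upper_density R A)%E ->
  forall N, exists2 n, (N <= n)%N & A n.
Proof.
move=> dA N; apply: contrapT => nA.
have AN n : A n -> (n < N)%N by move=> An; rewrite ltnNge; apply/negP => Nn; apply: nA; exists n.
pose u n : R := ((\sum_(1 <= k < n.+1) (k \in A))%N%:R / n%:R).
have uN n : u n <= N%:R / n%:R.
  rewrite /u ler_wpM2r ?invr_ge0// ler_nat.
  rewrite (@leq_trans (\sum_(1 <= k < n.+1) (k < N)))//.
    by apply: leq_sum => k _; case: (boolP (k \in A)) => //; rewrite inE => /AN ->.
  rewrite -big_mkcond /= sum1_count -size_filter -[leqRHS](size_iota 0).
  apply: uniq_leq_size; first by rewrite filter_uniq// iota_uniq.
  by move=> k; rewrite mem_filter mem_iota => /andP[].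
have le_m m : (0 < m)%N -> (upper_density R A <= (N%:R / m%:R)%:E)%E.
  move=> m0; apply: (@le_trans _ _ (ereal_sup ((fun n => (u n)%:E) @` [set n | (m <= n)%N]))).
    by apply: ereal_inf_lbound; exists [set n | (m <= n)%N] => //; exists m.
  apply: ge_ereal_sup => _ [n /= mn <-]; rewrite lee_fin (le_trans (uN n))//.
  by rewrite ler_wpM2l// lef_pV2 ?posrE ?ltr0n ?ler_nat// (leq_trans m0).
case: (upper_density R A) dA le_m => [r||] //; last by move=> _ /(_ 1%N isT).
rewrite lte_fin => r0 le_m.
have := le_m (Num.truncn (N%:R / r)).+1 isT; rewrite lee_fin leNgt => /negP; apply.
by rewrite ltr_pdivrMr ?ltr0n// mulrC -ltr_pdivrMr// truncnS_gt.
Qed.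

End Shift.

(** * Lower bounds for U-frequently hypercyclic functions *)

Section LowerBound.
Variables (R : realType) (alpha : R).
Implicit Types (a : nat -> R[i]) (f : R[i] -> R[i]).

(** The orbit visits [|g 0| > M] infinitely often, where
    [T^n f 0 = a_n (n + 1) ^ alpha]. *)
Lemma hypercyclic_coef f : U_frequently_hypercyclic alpha f ->
  exists2 a, sums a f & forall M N, exists2 n, (N <= n)%N &
    M < normc (a n) * n.+1%:R `^ alpha.
Proof.
move=> [/taylor[a af] dense]; exists a => // M N.
have ne : ([set g | M < normc (g 0)] : set (compact_convergence R)) `&` @analytic_disc R !=set0.
  exists (psum (fun=> (`|M| + 1)%:C%C) 1); split; last exact: psum_analytic.
  rewrite /mkset /psum big_nat1 expr0 mulr1 normc_real ger0_norm ?addr_ge0//.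
  by have := ler_norm M; lra.
have [n Nn] := density_gt0_unbounded (dense _ (open_large0 M) ne) N.
rewrite /mkset (sums_at0 (@sums_iter _ alpha _ _ n af)) addn0 ComplexField.Normc.normcM.
rewrite normc_real /iter_weight addn0 divr1 ger0_norm ?powR_ge0// => h.
by exists n.
Qed.

Lemma near_left1 (V : set R) : (1 : R)^'- V ->
  exists2 d : R, 0 < d & forall r, 1 - d < r -> r < 1 -> V r.
Proof.
move=> [d /= d0 dV]; exists d => // r r1 r2; apply: dV => //=.
by rewrite ger0_norm ?subr_ge0 ?ltW//; lra.
Qed.

(** This is [(1 + 1 / n) ^ n <= e], inverted. *)
Lemma pow_lower n : (expR (-1) : R) <= (1 - n.+1%:R^-1) ^+ n.
Proof.
case: n => [|n]; first by rewrite expr0 expR_le1; lra.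
have e : 1 - n.+2%:R^-1 = (1 + n.+1%:R^-1)^-1 :> R.
  have : 0 < n.+1%:R :> R by rewrite ltr0n.
  rewrite -[n.+2]addn1 natrD; move: (n.+1%:R : R) => x x0.
  by field; rewrite !gt_eqF ?addr_gt0.
rewrite e exprVn expRN lef_pV2 ?posrE ?expR_gt0 ?exprn_gt0 ?addr_gt0 ?invr_gt0//.
rewrite -[leRHS](_ : expR (n.+1%:R^-1) ^+ n.+1 = _); last first.
  by rewrite -expRM_natl mulfV// pnatr_eq0.
by rewrite lerXn2r ?nnegrE ?expR_ge0 ?expR_ge1Dx// addr_ge0// invr_ge0.
Qed.

(** For [n] with [|a_n| (n + 1) ^ alpha] large, test the circle of radius
    [1 - 1 / (n + 1)], where [r ^ n] stays above [exp (- 1)]. *)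
Lemma limsup_M1_infty f : U_frequently_hypercyclic alpha f ->
  limf_esup (fun r : R => ((1 - r) `^ (- alpha) * M1 f r)%:E) 1^'- = +oo%E.
Proof.
move=> /hypercyclic_coef[a af aM]; apply/eqP; rewrite -leye_eq.
apply: le_ereal_inf_tmp => _ [V /near_left1[d d0 dV] <-].
rewrite leye_eq; apply/eqP; apply: eq_infty => M.
(* The factor [expR 1] compensates the lower bound of [pow_lower]. *)
pose M' := `|M| * expR 1.
have [n Nn Mn] := aM M' (Num.truncn d^-1).+1.
have n0 : 0 < n.+1%:R :> R by rewrite ltr0n.
have nd : n.+1%:R^-1 < d.
  rewrite invf_plt ?posrE//.
  by rewrite (lt_le_trans (truncnS_gt _))// ler_nat leqW.
pose r : R := 1 - n.+1%:R^-1.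
have r01 : 0 < r < 1.
  rewrite subr_gt0 invf_lt1// ltr1n ltrBlDr ltrDl invr_gt0 n0 andbT ltnS.
  by case: n Nn {Mn n0 nd r}.
apply: (@le_trans _ _ ((1 - r) `^ (- alpha) * M1 f r)%:E); last first.
  apply: ereal_sup_ubound; exists r => //; apply: dV; last by case/andP: r01.
  by rewrite /r ltrD2l ltrN2.
rewrite lee_fin.
have -> : (1 - r) `^ (- alpha) = n.+1%:R `^ alpha.
  have -> : 1 - r = n.+1%:R `^ (-1) by rewrite /r opprB addrC subrK powR_inv1.
  by rewrite -powRrM mulN1r opprK.
have rn : expR (-1) <= r ^+ n by exact: pow_lower.
apply: le_trans (ler_wpM2l (powR_ge0 _ _) (coef_le_M1 n r01 af)).
rewrite mulrA mulrC [X in _ * X]mulrC (le_trans _ (ler_wpM2r _ rn))//; last first.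
  by rewrite mulr_ge0 ?normc_ge0 ?powR_ge0.
rewrite (@le_trans _ _ (expR (-1) * M'))//; last first.
  by rewrite ler_wpM2l ?expR_ge0// ltW.
by rewrite /M' mulrCA -expRD addNr expR0 mulr1 ler_norm.
Qed.

Lemma limsup_M1_gt0 f : U_frequently_hypercyclic alpha f ->
  (0 < limf_esup (fun r : R => (M1 f r)%:E) 1^'-)%E.
Proof.
move=> /hypercyclic_coef[a af aM].
have [n _ an] := aM 0 0%N.
have an0 : 0 < normc (a n).
  rewrite lt_neqAle normc_ge0 andbT eq_sym; apply: contraTneq an => ->.
  by rewrite mul0r ltxx.
apply: (@lt_le_trans _ _ (normc (a n) * (1 / 2) ^+ n)%:E).
  by rewrite lte_fin mulr_gt0// exprn_gt0.
apply: le_ereal_inf_tmp => _ [V /near_left1[d d0 dV] <-].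
pose r : R := Num.max (1 / 2) (1 - d / 2).
have r2 : 1 / 2 <= r by rewrite le_max lexx.
have rd : 1 - d / 2 <= r by rewrite le_max lexx orbT.
have r1 : r < 1 by rewrite gt_max; apply/andP; split; lra.
apply: (@le_trans _ _ (M1 f r)%:E); last first.
  apply: ereal_sup_ubound; exists r => //; apply: dV => //; lra.
have r01 : 0 < r < 1 by rewrite r1 andbT; lra.
rewrite lee_fin (le_trans _ (coef_le_M1 n r01 af))// ler_wpM2l ?normc_ge0//.
by rewrite lerXn2r ?nnegrE//; lra.
Qed.

End LowerBound.

(** * Polynomial growth against geometric decay *)

Section Growth.
Variable R : realType.
Implicit Types (A K C rho r e x y : R).

Lemma powR_expR_bound A : 0 <= A ->
  exists2 K, 0 < K & forall y, 0 <= y -> y `^ A * expR (- y) <= K.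
Proof.
move=> A0; pose m := (Num.truncn A).+1.
have mA : A <= m%:R by rewrite ltW// truncnS_gt.
have m0 : 0 < m%:R :> R by rewrite ltr0n.
exists (1 + m%:R ^+ m) => [|y y0]; first by rewrite ltr_pwDl// exprn_ge0.
rewrite expRN ler_pdivrMr ?expR_gt0//.
have e1 : 1 <= expR y by rewrite (le_trans _ (expR_ge1Dx _))// lerDl.
have [y1|y1] := leP y 1.
  rewrite (@le_trans _ _ (1 * 1))// ?mul1r.
    have -> : 1 = (1 : R) `^ A by rewrite powR1.
    by rewrite ge0_ler_powR// nnegrE.
  by rewrite (le_trans e1)// ler_peMl ?expR_ge0// lerDl exprn_ge0.
rewrite (@le_trans _ _ (y ^+ m))//.
  by rewrite -powR_mulrn// ler_powR// ltW.
rewrite mulrDl mul1r ler_wpDl ?expR_ge0//.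
have -> : y ^+ m = m%:R ^+ m * (y / m%:R) ^+ m.
  by rewrite -exprMn mulrCA divff ?mulr1// gt_eqF.
have -> : expR y = expR (y / m%:R) ^+ m.
  by rewrite -expRM_natl mulrCA divff ?mulr1// gt_eqF.
rewrite ler_wpM2l ?exprn_ge0// lerXn2r ?nnegrE ?expR_ge0 ?divr_ge0//.
by rewrite (le_trans _ (expR_ge1Dx _))// lerDr.
Qed.

(** The uniform form of the fact that polynomial growth is beaten by geometric
    decay: it is scale invariant in [X (1 - r)]. *)
Lemma powR_geometric_bound A : 0 <= A ->
  exists2 K, 0 < K & forall (X : nat) r, 0 < r < 1 ->
    X%:R `^ A * r ^+ X <= K * (1 - r) `^ (- A).
Proof.
move=> A0; have [K K0 KP] := powR_expR_bound A0; exists K => // X r /andP[r0 r1].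
have d0 : 0 < 1 - r by rewrite subr_gt0.
have rX : r ^+ X <= expR (- (X%:R * (1 - r))).
  rewrite -mulrN expRM_natl lerXn2r ?nnegrE ?expR_ge0 ?(ltW r0)//.
  by rewrite (le_trans _ (expR_ge1Dx _))// opprB addrC subrK.
have -> : X%:R `^ A = (X%:R * (1 - r)) `^ A * (1 - r) `^ (- A).
  rewrite powRM ?(ltW d0)// -mulrA -powRD ?subrr ?powRr0 ?mulr1//.
  by rewrite (gt_eqF d0) implybT.
rewrite mulrAC ler_wpM2r ?powR_ge0//.
rewrite (le_trans _ (KP (X%:R * (1 - r)) _)) ?mulr_ge0 ?(ltW d0)//.
by rewrite ler_wpM2l ?powR_ge0.
Qed.

Lemma powR_geometric_cvg0 A rho e : 0 <= A -> 0 < rho < 1 -> 0 < e ->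
  exists X0, forall X, (X0 <= X)%N -> X%:R `^ A * rho ^+ X <= e.
Proof.
move=> A0 r01 e0; have [K K0 KP] := powR_geometric_bound (addr_ge0 A0 ler01).
pose K' := K * (1 - rho) `^ (- (A + 1)).
exists (Num.truncn (K' / e)).+1 => X KX.
have X0 : 0 < X%:R :> R by rewrite ltr0n (leq_trans _ KX).
have := KP X rho r01; rewrite -/K'.
rewrite powRD; last by rewrite (gt_eqF X0) implybT.
rewrite powRr1 ?(ltW X0)// mulrAC => h.
rewrite -(ler_pM2r X0) (le_trans h)// mulrC -ler_pdivrMr//.
by rewrite ltW// (lt_le_trans (truncnS_gt _))// ler_nat.
Qed.

Lemma powR_geometric_dominated A rho : 0 <= A -> 0 < rho < 1 ->
  exists C q, [/\ 0 <= C, 0 <= q < 1 & forall k, k.+1%:R `^ A * rho ^+ k <= C * q ^+ k].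
Proof.
move=> A0 /andP[r0 r1]; pose q := (1 + rho) / 2.
have q0 : 0 < q by rewrite /q; lra.
have q1 : q < 1 by rewrite /q; lra.
have s01 : 0 < rho / q < 1.
  rewrite divr_gt0//= ltr_pdivrMr// mul1r /q; lra.
have [K K0 KP] := powR_geometric_bound A0.
have /andP[s0 s1] := s01.
exists (K * (1 - rho / q) `^ (- A) / (rho / q)), q; split.
- by rewrite divr_ge0 ?(ltW s0)// mulr_ge0 ?powR_ge0// ltW.
- by rewrite (ltW q0).
move=> k; have := KP k.+1 _ s01; rewrite exprSr mulrA -ler_pdivlMr//.
have -> : rho ^+ k = (rho / q) ^+ k * q ^+ k.
  by rewrite -exprMn divfK// gt_eqF.
by move=> h; rewrite mulrA ler_wpM2r// exprn_ge0// ltW.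
Qed.

Lemma iter_log_large l (B : R) : exists X, forall x, X <= x -> B <= iter_log l x.
Proof.
elim: l B => [|l IH] B; first by exists B.
have [X XP] := IH (expR B); exists X => x /XP h.
rewrite /iter_log /= -/(iter_log l x) -(expRK B) ler_ln ?posrE ?expR_gt0//.
exact: lt_le_trans (expR_gt0 B) h.
Qed.

Lemma iter_log_near1 l (B : R) : exists2 r1 : R, 0 < r1 < 1 &
  forall r, r1 <= r -> r < 1 -> B <= iter_log l (- ln (1 - r)).
Proof.
have [X XP] := iter_log_large l B.
pose Y := Num.max X 1.
have Y0 : 0 < Y by rewrite lt_max ltr01 orbT.
exists (1 - expR (- Y)) => [|r r1 r2].
  by rewrite subr_gt0 expR_lt1 oppr_lt0 Y0 /= ltrBlDr ltrDl expR_gt0.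
apply: XP; rewrite lerNr (@le_trans _ _ (- Y)) ?lerN2 ?le_max ?lexx//.
rewrite -[leRHS]expRK ler_ln ?posrE ?expR_gt0 ?subr_gt0//; lra.
Qed.

(** The functions [phi] for which [X ^ (- alpha) r ^ X = o(phi r)] as [X] tends
    to infinity, uniformly in [r]: up to constants the left-hand side is the
    circle mean of a block starting at degree [X]. *)
Definition majorant (alpha : R) (phi : R -> R) (r0 : R) :=
  [/\ 0 < r0 < 1, (forall r, r0 <= r -> r < 1 -> 0 <= phi r) &
   forall C e, 0 < C -> 0 < e -> exists X0, forall X, (X0 <= X)%N ->
     forall r, r0 <= r -> r < 1 -> C * X%:R `^ (- alpha) * r ^+ X <= e * phi r].

Lemma majorant_pos alpha : 0 < alpha -> majorant alpha (fun=> 1) (1 / 2).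
Proof.
move=> a0; split=> [|//|C e C0 e0]; first by apply/andP; split; lra.
have Ce : 0 < C / e by rewrite divr_gt0.
exists (Num.truncn ((C / e) `^ alpha^-1)).+1 => X XX r r0 r1.
have X0 : 0 < X%:R :> R by rewrite ltr0n (leq_trans _ XX).
rewrite mulr1 (@le_trans _ _ (C * X%:R `^ (- alpha)))//.
  rewrite ler_piMr ?mulr_ge0 ?powR_ge0 ?(ltW C0)// exprn_ile1//; lra.
rewrite powRN ler_pdivrMr ?powR_gt0// mulrC -ler_pdivrMr//.
have -> : C / e = ((C / e) `^ alpha^-1) `^ alpha.
  by rewrite -powRrM mulVf ?gt_eqF// powRr1// ltW.
rewrite ge0_ler_powR ?nnegrE ?powR_ge0 ?(ltW a0) ?(ltW X0)//.
by rewrite ltW// (lt_le_trans (truncnS_gt _))// ler_nat.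
Qed.

(** Near [1] the unbounded factor absorbs the constant of
    [powR_geometric_bound]; away from [1] the left-hand side tends to zero
    uniformly while [phi >= 1]. *)
Lemma majorant_neg alpha l : alpha < 0 -> exists r0,
  majorant alpha (fun r => (1 - r) `^ alpha * iter_log l (- ln (1 - r))) r0.
Proof.
move=> a0; have [r0 r001 r0P] := iter_log_near1 l 1.
have A0 : 0 <= - alpha by rewrite oppr_ge0 ltW.
have [K K0 KP] := powR_geometric_bound A0.
have phi1 r : r0 <= r -> r < 1 -> 1 <= (1 - r) `^ alpha * iter_log l (- ln (1 - r)).
  move=> r0r r1; rewrite -[leLHS]mul1r ler_pM ?ler01 ?r0P//.
  rewrite -[leLHS](powRr0 (1 - r)) ger_powR ?(ltW a0)// subr_gt0 r1 /= lerBlDr lerDl.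
  by case/andP: r001 => h _; apply: le_trans r0r; exact: ltW.
exists r0; split=> // [r r0r r1|C e C0 e0]; first by rewrite (le_trans ler01)// phi1.
have [r1 r101 r1P] := iter_log_near1 l (K * C / e).
have [X0 X0P] := powR_geometric_cvg0 A0 r101 (divr_gt0 e0 C0).
exists X0 => X /X0P XX r r0r r1'.
have r00 : 0 < r by case/andP: r001 => h _; exact: lt_le_trans h r0r.
have [rr|rr] := leP r1 r.
  rewrite (@le_trans _ _ (C * (K * (1 - r) `^ alpha)))//.
    have := KP X r; rewrite opprK r00 r1' => /(_ isT) h.
    by rewrite -mulrA ler_wpM2l// ltW.
  have := r1P r rr r1'; rewrite ler_pdivrMr// => h.
  have := ler_wpM2r (powR_ge0 (1 - r) alpha) h.
  by congr (_ <= _); ring.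
rewrite (@le_trans _ _ e)//; last by rewrite -[leLHS]mulr1 ler_wpM2l ?(ltW e0)// phi1.
rewrite -mulrA mulrC -ler_pdivlMr// (le_trans _ XX)// ler_wpM2l ?powR_ge0//.
by rewrite lerXn2r ?nnegrE ?(ltW r00)// ltW//; case/andP: r101.
Qed.

End Growth.

(** * The trapezoidal kernel *)

Section Kernel.
Variable R : realType.
Implicit Types (z w : R[i]).

Lemma normc_sqr z : normc z ^+ 2 = complex.Re z ^+ 2 + complex.Im z ^+ 2.
Proof. by case: z => x y /=; rewrite sqr_sqrtr// addr_ge0// sqr_ge0. Qed.

Lemma sqr_geometricE (r t : R) s n :
  normc (\sum_(0 <= j < n) (r%:C%C * expi t) ^+ (s * j)) ^+ 2 =
  \sum_(0 <= j < n) \sum_(0 <= l < n) (r ^+ (s * j) * r ^+ (s * l)) *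
    (cos ((s * j)%:R * t) * cos ((s * l)%:R * t)
     + sin ((s * j)%:R * t) * sin ((s * l)%:R * t)).
Proof.
rewrite normc_sqr Re_sum Im_sum.
pose c j := r ^+ (s * j) * cos ((s * j)%:R * t).
pose d j := r ^+ (s * j) * sin ((s * j)%:R * t).
have cd j : (r%:C%C * expi t) ^+ (s * j) = (c j +i* d j)%C.
  rewrite exprMn -rmorphXn expiX /expi; apply/eqP; rewrite eq_complex /=.
  by rewrite !mul0r subr0 addr0 !eqxx.
under eq_bigr do rewrite cd /=.
under [X in _ + X ^+ 2]eq_bigr do rewrite cd /=.
rewrite !expr2 !mulr_suml -big_split; apply: eq_bigr => j _ /=.
rewrite !mulr_sumr -big_split; apply: eq_bigr => l _ /=.
by rewrite /c /d; ring.
Qed.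

Let continuous_kernel (s : nat) j l : continuous (fun t : R =>
  cos ((s * j)%:R * t) * cos ((s * l)%:R * t)
  + sin ((s * j)%:R * t) * sin ((s * l)%:R * t)).
Proof.
by move=> t; apply: cvgD; apply: cvgM; (exact: continuous_cosM || exact: continuous_sinM).
Qed.

Lemma continuous_sqr_geometric (r : R) s n : continuous (fun t : R =>
  normc (\sum_(0 <= j < n) (r%:C%C * expi t) ^+ (s * j)) ^+ 2).
Proof.
rewrite (funext (fun t => sqr_geometricE r t s n)).
apply: continuous_sumr => j; apply: continuous_sumr => l t.
by apply: cvgM; [exact: cvg_cst|exact: continuous_kernel].
Qed.

(** Parseval for [\sum_j z ^ (s j)]. *)
Lemma mean_sqr_geometric (r : R) s n : 0 < r < 1 -> (0 < s)%N ->
  circ (fun t : R => normc (\sum_(0 <= j < n) (r%:C%C * expi t) ^+ (s * j)) ^+ 2) <= n%:R.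
Proof.
move=> /andP[r0 r1] s0.
rewrite (funext (fun t => sqr_geometricE r t s n)).
have cG j l : continuous (fun t : R => (r ^+ (s * j) * r ^+ (s * l)) *
    (cos ((s * j)%:R * t) * cos ((s * l)%:R * t)
     + sin ((s * j)%:R * t) * sin ((s * l)%:R * t))).
  by move=> t; apply: cvgM; [exact: cvg_cst|exact: continuous_kernel].
rewrite circ_sum => [|j]; last by apply: continuous_sumr.
rewrite -[leRHS]mulr1 -[n in leRHS]subn0 mulr_natl -sumr_const_nat.
apply: ler_sum_nat => j /andP[_ jn]; rewrite circ_sum//.
rewrite (eq_bigr (fun l => r ^+ (s * j) * r ^+ (s * l) * (j == l)%:R)) => [|l _]; last first.
  by rewrite circZ// circ_cosB eqn_pmul2l.
rewrite (bigD1_seq j) ?mem_index_iota ?iota_uniq//= eqxx mulr1 big1 => [|l /negPf lj].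
  by rewrite addr0 mulr_ile1 ?exprn_ge0 ?exprn_ile1// ltW.
by rewrite eq_sym lj mulr0.
Qed.

(** The trapezoidal profile: the coefficients of
    [(\sum_(i < 2 N) w ^ i) (\sum_(l < N) w ^ l)], which are all equal to [N]
    on the window [N, 2 N). *)
Definition trapezoid N j := \sum_(0 <= l < N) ((l <= j) && (j < l + 2 * N) : nat)%N.

Lemma trapezoid_le N j : (trapezoid N j <= N)%N.
Proof.
rewrite /trapezoid -[leqRHS]subn0 -[leqRHS]muln1 -sum_nat_const_nat.
by apply: leq_sum => l _; case: (_ && _).
Qed.

Lemma trapezoid_out N j : (3 * N <= j)%N -> trapezoid N j = 0%N.
Proof.
move=> jN; rewrite /trapezoid big_nat_cond big1// => l; rewrite andbT => /andP[_ lN].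
have lj : (l + 2 * N <= j)%N.
  by rewrite (leq_trans _ jN)// [(3 * N)%N]mulSn leq_add2r ltnW.
by rewrite [(j < _)%N]ltnNge lj andbF.
Qed.

Lemma trapezoid_window N j : (N <= j < 2 * N)%N -> trapezoid N j = N.
Proof.
move=> /andP[Nj j2N]; rewrite /trapezoid (eq_big_nat _ _ (F2 := fun=> 1%N)).
  by rewrite sum_nat_const_nat subn0 muln1.
move=> l /andP[_ lN]; rewrite (leq_trans (ltnW lN))//=.
by rewrite (leq_trans j2N)// leq_addl.
Qed.

Lemma trapezoid_prod N w :
  (\sum_(0 <= i < 2 * N) w ^+ i) * (\sum_(0 <= l < N) w ^+ l) =
  \sum_(0 <= j < 3 * N) (trapezoid N j)%:R * w ^+ j.
Proof.
rewrite [RHS](eq_bigr (fun j => \sum_(0 <= l < N)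
    (((l <= j) && (j < l + 2 * N))%N)%:R * w ^+ j)); last first.
  by move=> j _; rewrite /trapezoid natr_sum mulr_suml.
rewrite exchange_big /= mulrC mulr_suml; apply: eq_big_nat => l /andP[_ lN].
pose G j := (((l <= j) && (j < l + 2 * N))%N)%:R * w ^+ j.
have G0 m n : (forall j, (m <= j < n)%N -> (l <= j) && (j < l + 2 * N) = false)%N ->
    \sum_(m <= j < n) G j = 0.
  move=> mn; rewrite big_nat_cond big1// => j; rewrite andbT => /mn mnj.
  by rewrite /G mnj mul0r.
rewrite -[RHS]/(\sum_(0 <= j < 3 * N) G j).
rewrite [RHS](big_cat_nat (n := l)) ?leq0n//=; last first.
  by rewrite (leq_trans (ltnW lN))// leq_pmull.
rewrite [X in _ = X + _]G0 ?add0r; last first.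
  by move=> j /andP[_ jl]; rewrite leqNgt jl.
rewrite [RHS](big_cat_nat (n := l + 2 * N)) ?leq_addr//=; last first.
  by rewrite [(3 * N)%N]mulSn leq_add2r ltnW.
rewrite [X in _ = _ + X]G0 ?addr0; last first.
  by move=> j /andP[jl _]; rewrite [(j < _)%N]ltnNge jl andbF.
rewrite -[X in \sum_(X <= _ < _) G _]add0n big_addn addKn mulr_sumr.
apply: eq_big_nat => i /andP[_ iN].
by rewrite /G leq_addl addnC ltn_add2l iN mul1r exprD mulrC.
Qed.

Lemma big_divmod (V : zmodType) (F : nat -> nat -> V) s L : (0 < s)%N ->
  \sum_(0 <= m < L * s) F (m %/ s)%N (m %% s)%N =
  \sum_(0 <= j < L) \sum_(0 <= k < s) F j k.
Proof.
move=> s0; elim: L => [|L IH]; first by rewrite mul0n !big_geq.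
rewrite big_nat_recr//= -IH mulSn addnC (big_cat_nat (n := L * s)) ?leq_addr//=.
congr (_ + _); rewrite -{1}[(L * s)%N]add0n big_addn addKn.
apply: eq_big_nat => k /andP[_ ks].
by rewrite addnC divnMDl// divn_small// addn0 modnMDl modn_small.
Qed.

End Kernel.

(** * Blocks steering the orbit along one window *)

Section Block.
Variables (R : realType) (alpha : R).
Implicit Types (p : nat -> R[i]) (z : R[i]).

Lemma powR_dev (x y : R) : 1 <= x -> x <= y -> `|x `^ alpha - 1| <= y `^ `|alpha| - 1.
Proof.
move=> x1 xy; have x0 : 0 < x by exact: lt_le_trans x1.
have y0 : 0 < y by exact: lt_le_trans xy.
have xyA : x `^ `|alpha| <= y `^ `|alpha| by rewrite ge0_ler_powR ?nnegrE ?(ltW x0) ?(ltW y0).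
have xA1 : 1 <= x `^ `|alpha| by rewrite -(powRr0 x) ler_powR.
have u : x `^ alpha <= x `^ `|alpha| by rewrite ler_powR// ler_norm.
have l : x `^ (- `|alpha|) <= x `^ alpha by rewrite ler_powR// lerNl -normrN ler_norm.
rewrite ler_norml; apply/andP; split; last by lra.
suff : 1 - x `^ (- `|alpha|) <= x `^ `|alpha| - 1 by lra.
rewrite powRN; set v := x `^ `|alpha| in xA1 *.
have v0 : 0 < v by lra.
have -> : 1 - v^-1 = (v - 1) / v by rewrite mulrBl divff ?gt_eqF// mul1r.
by rewrite ler_pdivrMr// ler_peMr// subr_ge0.
Qed.

Definition weighted p d k : R[i] := if (k < d)%N then p k * (k.+1%:R `^ alpha)%:C%C else 0.

Definition weighted_norm p d : R := \sum_(0 <= k < d) normc (weighted p d k).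

(** The Taylor coefficients of
    [X ^ (- alpha) z ^ X P(z) K(z ^ s)], for [d <= s], where [P] is the
    polynomial of coefficients [weighted p d] and [K] has coefficients [trapezoid N _ / N]. *)
Definition block p d s X N m : R[i] := if (m < X)%N then 0 else
  (X%:R `^ (- alpha) * ((trapezoid N ((m - X) %/ s))%:R / N%:R))%:C%C *
  weighted p d ((m - X) %% s).

Lemma weighted_norm_ge0 p d : 0 <= weighted_norm p d.
Proof. by apply: sumr_ge0 => k _; exact: normc_ge0. Qed.

Lemma weighted_le p d k : normc (weighted p d k) <= weighted_norm p d.
Proof.
have [kd|dk] := ltnP k d; last first.
  by rewrite /weighted ltnNge dk ComplexField.Normc.normc0 weighted_norm_ge0.
rewrite /weighted_norm (bigD1_seq k) ?mem_index_iota ?iota_uniq//= lerDl.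
by apply: sumr_ge0 => i _; exact: normc_ge0.
Qed.

Lemma block_lo p d s X N m : (m < X)%N -> block p d s X N m = 0.
Proof. by rewrite /block => ->. Qed.

Lemma block_hi p d s X N m : (0 < s)%N -> (X + 3 * N * s <= m)%N ->
  block p d s X N m = 0.
Proof.
move=> s0 Xm; rewrite /block ltnNge (leq_trans (leq_addr _ _) Xm)/=.
rewrite trapezoid_out ?mul0r ?mulr0 ?mul0r//.
by rewrite leq_divRL// leq_subRL// (leq_trans (leq_addr _ _) Xm).
Qed.

Lemma block_le p d s X N m :
  normc (block p d s X N m) <= X%:R `^ (- alpha) * weighted_norm p d.
Proof.
rewrite /block; case: ifP => _.
  by rewrite ComplexField.Normc.normc0 mulr_ge0 ?powR_ge0 ?weighted_norm_ge0.
rewrite ComplexField.Normc.normcM normc_real ger0_norm ?mulr_ge0 ?powR_ge0 ?invr_ge0//.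
rewrite ler_pM ?mulr_ge0 ?powR_ge0 ?invr_ge0 ?normc_ge0 ?weighted_le//.
rewrite ler_piMr ?powR_ge0//; case: N => [|N]; first by rewrite invr0 mulr0.
by rewrite ler_pdivrMr ?ltr0n// mul1r ler_nat trapezoid_le.
Qed.

Lemma block_sum p d s X N z : (0 < s)%N -> (d <= s)%N ->
  psum (block p d s X N) (X + 3 * N * s) z =
  z ^+ X * (X%:R `^ (- alpha) / N%:R)%:C%C * psum (weighted p d) s z *
  ((\sum_(0 <= i < 2 * N) z ^+ (s * i)) * (\sum_(0 <= l < N) z ^+ (s * l))).
Proof.
move=> s0 ds; rewrite /psum (big_cat_nat (n := X)) ?leq_addr//=.
rewrite big_nat_cond big1 ?add0r => [|m]; last first.
  by rewrite andbT => /andP[_ mX]; rewrite block_lo ?mul0r.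
rewrite -{1}[X]add0n big_addn addKn.
under [X in _ = _ * (X * _)]eq_bigr do rewrite exprM.
under [X in _ = _ * (_ * X)]eq_bigr do rewrite exprM.
rewrite trapezoid_prod -!mulrA mulr_suml.
pose F j k : R[i] := weighted p d k * z ^+ k * ((trapezoid N j)%:R * (z ^+ s) ^+ j).
rewrite (eq_bigr (fun m => z ^+ X * ((X%:R `^ (- alpha) / N%:R)%:C%C * F (m %/ s)%N (m %% s)%N))).
  rewrite -mulr_sumr -mulr_sumr (big_divmod F)// exchange_big /=.
  by congr (_ * (_ * _)); apply: eq_bigr => k _; rewrite mulr_sumr.
move=> m _; rewrite /block addnC ltnNge leq_addr /= addKn exprD mulrCA; congr (_ * _).
rewrite /F -exprM {3}(divn_eq m s) exprD [(m %/ s * s)%N]mulnC.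
by rewrite !rmorphM /= (rmorph_nat (real_complex R)); ring.
Qed.

(** By [2 |A B| <= |A| ^ 2 + |B| ^ 2] and Parseval, the two geometric sums of
    the kernel contribute at most [(2 N + N) / (2 N)]. *)
Lemma M1_block p d s X N (r : R) : (0 < s)%N -> (d <= s)%N -> (0 < N)%N -> 0 < r < 1 ->
  M1 (psum (block p d s X N) (X + 3 * N * s)) r <=
  (2 * weighted_norm p d) * X%:R `^ (- alpha) * r ^+ X.
Proof.
move=> s0 ds N0 r01; have /andP[r0 r1] := r01.
have N0' : 0 < N%:R :> R by rewrite ltr0n.
pose D := weighted_norm p d; have D0 : 0 <= D := weighted_norm_ge0 p d.
pose c := r ^+ X * (X%:R `^ (- alpha) / N%:R) * D / 2.
have c0 : 0 <= c by rewrite !mulr_ge0 ?exprn_ge0 ?powR_ge0 ?invr_ge0// ltW.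
pose a n t := normc (\sum_(0 <= i < n) (r%:C%C * expi t) ^+ (s * i)) ^+ 2.
have ca n : continuous (a n) by exact: continuous_sqr_geometric.
have cs : continuous (fun t => a (2 * N)%N t + a N t).
  by move=> t; apply: cvgD; exact: ca.
apply: (@le_trans _ _ (circ (fun t => c * (a (2 * N)%N t + a N t)))).
  rewrite M1E; apply: le_circ => [||t].
  - exact: (continuous_circle r01 (@psum_analytic _ _ _)).
  - by move=> t; apply: cvgM; [exact: cvg_cst|exact: cs].
  have zr := normc_circle t (ltW r0); set z := _ * expi t in zr *.
  rewrite block_sum// !ComplexField.Normc.normcM normcX zr normc_real.
  rewrite ger0_norm ?mulr_ge0 ?powR_ge0 ?invr_ge0//.
  have Dz : normc (psum (weighted p d) s z) <= D.
    rewrite (le_trans (normc_sum _ _ _))// /D /weighted_norm.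
    rewrite (big_cat_nat (n := d)) ?leq0n//= [X in _ + X]big_nat_cond.
    rewrite [X in _ + X]big1 ?addr0.
      apply: ler_sum => k _; rewrite ComplexField.Normc.normcM normcX zr.
      by rewrite ler_piMr ?normc_ge0// exprn_ile1// ltW.
    move=> k; rewrite andbT => /andP[dk _].
    by rewrite /weighted ltnNge dk mul0r ComplexField.Normc.normc0.
  rewrite /c -[_ * D / 2]mulrA -[_ * (D / 2) * _]mulrA -mulrA.
  rewrite ler_wpM2l ?mulr_ge0 ?exprn_ge0 ?powR_ge0 ?invr_ge0 ?(ltW r0)//.
  rewrite -[_ / 2 * _]mulrA ler_pM ?mulr_ge0 ?normc_ge0//.
  rewrite /a -/z; set x := normc _; set y := normc _.
  have := sqr_ge0 (x - y); rewrite sqrrB; lra.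
rewrite circZ// circD//.
have h2 := mean_sqr_geometric (2 * N) r01 s0; have h1 := mean_sqr_geometric N r01 s0.
rewrite (le_trans (ler_wpM2l c0 (lerD h2 h1)))// natrM /c.
rewrite (_ : _ * _ = (3 / 2) * (D * (X%:R `^ (- alpha) * r ^+ X))); last first.
  by field; rewrite gt_eqF.
have Y0 : 0 <= D * (X%:R `^ (- alpha) * r ^+ X).
  by rewrite !mulr_ge0 ?powR_ge0 ?exprn_ge0// ltW.
rewrite -/D -[2 * D * _ * _]mulrA -[2 * D * _]mulrA.
lra.
Qed.

Lemma powR_inv_base (x : R) : 0 <= x -> x `^ (- alpha) = x^-1 `^ alpha.
Proof. by move=> x0; rewrite -(powR_inv1 x0) -powRrM mulN1r. Qed.

(** The weight [(k + 1) ^ alpha] put on the coefficients cancels the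
    denominator of the weight of [T^n]; the remaining factor is close to one
    when the window is short compared with [X]. *)
Lemma block_window p d s X N j k : (d <= s)%N -> (0 < N)%N -> (N <= j < 2 * N)%N ->
  (0 < X)%N -> (k < s)%N ->
  block p d s X N (X + s * j + k) * (iter_weight alpha (X + s * j) k)%:C%C =
  if (k < d)%N then p k * (((X + s * j + k).+1%:R / X%:R) `^ alpha)%:C%C else 0.
Proof.
move=> ds N0 jN X0 ks; rewrite /block ltnNge -addnA leq_addr /= addKn.
rewrite mulnC divnMDl ?(leq_trans _ ks)// divn_small// addn0 modnMDl modn_small//.
rewrite trapezoid_window// divff ?pnatr_eq0 -?lt0n// mulr1 /weighted.
case: ifP => [kd|_]; last by rewrite mulr0 mul0r.
rewrite mulrCA -mulrA -!rmorphM /=; congr (_ * _%:C%C).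
rewrite powR_inv_base// /iter_weight addnA -powRM ?invr_ge0//.
rewrite -powRM ?mulr_ge0 ?invr_ge0 ?divr_ge0//; congr (_ `^ _).
rewrite mulrCA mulrC -!mulrA mulrCA.
by rewrite [X in _ * X]mulrCA mulVKf ?pnatr_eq0// mulrC.
Qed.

(** Past the first copy of the polynomial the coefficients of [T^n] grow
    polynomially only, with constants that do not depend on [X] and [N]: the
    support ends before [2 X], so that [(n + k + 1) / X] stays in [1, 2]. *)
Lemma block_tail p d s X N n k : (0 < s)%N -> (0 < X)%N -> (X <= n)%N -> (3 * N * s <= X)%N ->
  normc (block p d s X N (n + k) * (iter_weight alpha n k)%:C%C) <=
  weighted_norm p d * 2 `^ `|alpha| * k.+1%:R `^ `|alpha|.
Proof.
move=> s0 X0 Xn NX; have [hi|lo] := leqP (X + 3 * N * s) (n + k).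
  rewrite block_hi// mul0r ComplexField.Normc.normc0.
  by rewrite !mulr_ge0 ?powR_ge0 ?weighted_norm_ge0.
have X0' : 0 < X%:R :> R by rewrite ltr0n.
rewrite ComplexField.Normc.normcM normc_real ger0_norm ?powR_ge0//.
rewrite (le_trans (ler_wpM2r (powR_ge0 _ _) (block_le _ _ _ _ _ _)))//.
rewrite mulrAC mulrC -mulrA ler_wpM2l ?weighted_norm_ge0//.
rewrite powR_inv_base// /iter_weight -[leLHS]powRM ?invr_ge0 ?divr_ge0//.
set x : R := (n + k).+1%:R / X%:R.
have -> : X%:R^-1 * ((n + k).+1%:R / k.+1%:R) = x * (k.+1%:R)^-1 by rewrite /x mulrCA mulrA.
have x1 : 1 <= x.
  by rewrite /x ler_pdivlMr// mul1r ler_nat (leq_trans Xn)// leqW// leq_addr.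
have x2 : x <= 2.
  rewrite /x ler_pdivrMr// -natrM ler_nat mul2n -addnn.
  by rewrite (leq_trans lo)// leq_add2l.
rewrite powRM ?invr_ge0//; last by lra.
rewrite ler_pM ?powR_ge0//.
  rewrite (@le_trans _ _ (x `^ `|alpha|)) ?ler_powR ?ler_norm//.
  by rewrite ge0_ler_powR ?nnegrE//; lra.
by rewrite -powR_inv_base// ler_powR ?ler1n// -normrN ler_norm.
Qed.

(** The coefficients of index less than [s] differ from those of the polynomial
    by the weights of the window, the others form a tail. *)
Lemma block_approx p d s X N j (h rho : R) K z :
  (d <= s)%N -> (0 < s)%N -> (0 < N)%N -> (N <= j < 2 * N)%N -> (0 < X)%N ->
  (3 * N * s <= X)%N -> 0 <= h -> (2 * N * s)%:R <= h * X%:R ->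
  normc z <= rho -> rho <= 1 -> (s <= K)%N ->
  normc (psum (fun k => block p d s X N (X + s * j + k) *
                        (iter_weight alpha (X + s * j) k)%:C%C) K z - psum p d z)
  <= (\sum_(0 <= k < d) normc (p k)) * ((1 + h) `^ `|alpha| - 1) +
     weighted_norm p d * 2 `^ `|alpha| *
       \sum_(s <= k < K) k.+1%:R `^ `|alpha| * rho ^+ k.
Proof.
move=> ds s0 N0 jN X0 NX h0 hX zr r1 sK.
have X0' : 0 < X%:R :> R by rewrite ltr0n.
have z1 : normc z <= 1 by exact: le_trans r1.
rewrite /psum (big_cat_nat (n := s)) ?leq0n//= addrAC (le_trans (le_normcD _ _))// lerD//.
  rewrite (big_cat_nat (n := d)) ?leq0n//= [X in _ + X - _]big_nat_cond.
  rewrite [X in _ + X - _]big1 ?addr0 => [|k]; last first.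
    by rewrite andbT => /andP[dk ks]; rewrite block_window// ltnNge dk mul0r.
  rewrite -sumrB (le_trans (normc_sum _ _ _))// mulr_suml.
  rewrite big_nat_cond [leRHS]big_nat_cond; apply: ler_sum => k; rewrite andbT => /andP[_ kd].
  have ks : (k < s)%N by exact: leq_trans kd ds.
  rewrite block_window// kd.
  set x := _ / X%:R.
  have -> : p k * (x `^ alpha)%:C%C * z ^+ k - p k * z ^+ k =
      p k * ((x `^ alpha - 1)%:C%C * z ^+ k).
    by rewrite rmorphB rmorph1; ring.
  rewrite !ComplexField.Normc.normcM ler_wpM2l ?normc_ge0// normc_real normcX.
  rewrite (@le_trans _ _ `|x `^ alpha - 1|)//.
    by rewrite ler_piMr// exprn_ile1 ?normc_ge0.
  apply: powR_dev.
    by rewrite /x ler_pdivlMr// mul1r ler_nat leqW// -addnA leq_addr.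
  rewrite /x ler_pdivrMr// mulrDl mul1r (le_trans _ (lerD (lexx _) hX))//.
  rewrite -natrD ler_nat -addnA -addnS leq_add2l mulnC.
  have /andP[_ j2] := jN.
  rewrite (@leq_trans (j * s + s))//; first by rewrite -addnS leq_add2l.
  by rewrite -mulSnr leq_mul2r j2 orbT.
rewrite (le_trans (normc_sum _ _ _))// mulr_sumr; apply: ler_sum => k _.
rewrite ComplexField.Normc.normcM mulrA ler_pM ?normc_ge0//.
  by apply: block_tail => //; exact: leq_addr.
by rewrite normcX lerXn2r ?nnegrE ?normc_ge0// (le_trans (normc_ge0 z)).
Qed.

End Block.

(** * Choosing the parameters of a block *)

Section Piece.
Variables (R : realType) (alpha : R).
Implicit Types (p : nat -> R[i]) (z : R[i]).

Lemma powR_near1 (A P e : R) : 0 <= A -> 0 <= P -> 0 < e ->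
  exists2 h : R, 0 < h & P * ((1 + h) `^ A - 1) <= e.
Proof.
move=> A0 P0 e0; have eP : 0 < e / (P + 1) by rewrite divr_gt0//; lra.
have /cvgrPdist_lt/(_ _ eP)[d /= d0 dP] := @continuous_expR R 0.
pose h := d / 2 / (A + 1).
have h0 : 0 < h by rewrite !divr_gt0//; lra.
exists h => //.
have hA : A * h <= d / 2.
  rewrite /h mulrCA ler_piMr ?divr_ge0 ?(ltW d0)//.
  by rewrite ler_pdivrMr//; lra.
have Ah0 : 0 <= A * h by rewrite mulr_ge0// ltW.
have : (1 + h) `^ A <= expR (A * h).
  rewrite /powR gt_eqF; last by lra.
  by rewrite ler_expR ler_wpM2l// le_ln1Dx// (lt_trans _ h0)// ltrN10.
have Ahd : A * h < d by lra.
have := dP (A * h); rewrite /= sub0r normrN (ger0_norm Ah0) expR0 distrC => /(_ Ahd).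
move=> /ltr_normlW h1 h2.
have {}h2 : (1 + h) `^ A - 1 <= e / (P + 1) by lra.
rewrite (le_trans (ler_wpM2l P0 h2))// mulrCA ler_piMr ?(ltW e0)//.
by rewrite ler_pdivrMr//; lra.
Qed.

(** Choice of the spacing [s] and of the ratio [t] between the starting degree
    and the length of a block, independently of that length. *)
Lemma block_params p d (rho e : R) : 0 < rho < 1 -> 0 < e ->
  exists s t : nat, [/\ (0 < s)%N, (d <= s)%N, (3 * s <= t)%N &
  forall N j K z, (0 < N)%N -> (N <= j < 2 * N)%N -> (s <= K)%N -> normc z <= rho ->
  normc (psum (fun k => block alpha p d s (t * N) N (t * N + s * j + k) *
      (iter_weight alpha (t * N + s * j) k)%:C%C) K z - psum p d z) <= e].
Proof.
move=> r01 e0; have e2 : 0 < e / 2 by rewrite divr_gt0.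
pose P := \sum_(0 <= k < d) normc (p k).
have P0 : 0 <= P by apply: sumr_ge0 => k _; exact: normc_ge0.
pose B := weighted_norm alpha p d * 2 `^ `|alpha|.
have B0 : 0 <= B by rewrite mulr_ge0 ?powR_ge0// weighted_norm_ge0.
have [C [q [C0 q01 Cq]]] := powR_geometric_dominated (normr_ge0 alpha) r01.
have [n0 n0P] := geo_small (B * (C / (1 - q))) q01 e2.
(* [s] makes the tail [\sum_(k >= s) (k + 1) ^ |alpha| rho ^ k] small, and [t]
   makes the weights of the window close to one. *)
pose s := maxn (maxn n0 d) 1.
have s0 : (0 < s)%N by rewrite leq_max orbT.
have ds : (d <= s)%N by rewrite !leq_max leqnn orbT.
have ns : (n0 <= s)%N by rewrite !leq_max leqnn.
have [h h0 hP] := powR_near1 (normr_ge0 alpha) P0 e2.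
pose t := maxn (3 * s) (Num.truncn ((2 * s)%:R / h)).+1.
have st : (3 * s <= t)%N by rewrite leq_max leqnn.
have ht : (2 * s)%:R <= h * t%:R.
  rewrite mulrC -ler_pdivrMr// ltW// (lt_le_trans (truncnS_gt _))// ler_nat.
  by rewrite leq_max leqnn orbT.
exists s, t; split=> // N j K z N0 jN sK zr.
have X0 : (0 < t * N)%N.
  by rewrite muln_gt0 N0 andbT (leq_trans _ st)// muln_gt0 s0.
have NX : (3 * N * s <= t * N)%N by rewrite mulnAC leq_mul2r st orbT.
have hX : (2 * N * s)%:R <= h * (t * N)%:R.
  by rewrite mulnAC natrM [leRHS](_ : _ = h * t%:R * N%:R) ?ler_wpM2r// natrM mulrA.
have r1 : rho <= 1 by case/andP: r01 => _ /ltW.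
have := @block_approx _ alpha p _ _ _ _ _ _ _ _ _ ds s0 N0 jN X0 NX (ltW h0) hX zr r1 sK.
move=> /le_trans; apply; rewrite [leRHS]splitr lerD//.
rewrite (le_trans _ (ltW (n0P _ ns)))// -/B -mulrA ler_wpM2l//.
rewrite (@le_trans _ _ (\sum_(s <= k < s + (K - s)) C * q ^+ k))//.
  by rewrite subnKC//; apply: ler_sum.
by rewrite -mulr_sumr mulrAC -mulrA ler_wpM2l// geo_sum_le.
Qed.

Lemma sum_bounded_support (f : nat -> R) (b : R) H K :
  (forall k, f k <= b) -> (forall k, (H <= k)%N -> f k = 0) -> 0 <= b ->
  \sum_(0 <= k < K) f k <= H%:R * b.
Proof.
move=> fb f0 b0; have [KH|HK] := leqP K H.
  rewrite (@le_trans _ _ (\sum_(0 <= k < K) b)) ?ler_sum//.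
  by rewrite sumr_const_nat subn0 -[leLHS]mulr_natl ler_wpM2r// ler_nat.
rewrite (big_cat_nat (n := H)) ?(ltnW HK)//= [X in _ + X]big_nat_cond [X in _ + X]big1 ?addr0.
  rewrite (@le_trans _ _ (\sum_(0 <= k < H) b)) ?ler_sum//.
  by rewrite sumr_const_nat subn0 -[leLHS]mulr_natl.
by move=> k; rewrite andbT => /andP[/f0].
Qed.

Lemma iter_weight_le n k : iter_weight alpha n k <= n.+1%:R `^ `|alpha|.
Proof.
rewrite /iter_weight; set x : R := _ / _.
have x1 : 1 <= x by rewrite /x ler_pdivlMr ?ltr0n// mul1r ler_nat ltnS leq_addl.
have xn : x <= n.+1%:R.
  rewrite /x ler_pdivrMr ?ltr0n// -natrM ler_nat mulSn -addnS.
  by rewrite [leqLHS]addnC leq_add2l leq_pmulr.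
rewrite (@le_trans _ _ (x `^ `|alpha|)) ?ler_powR ?ler_norm//.
by rewrite ge0_ler_powR ?nnegrE//; lra.
Qed.

(** What the superposition needs from its [i]-th summand [q]: it starts after
    the degree [D] where the previous ones end, it does not disturb the times
    [n <= D] that they serve, its circle means are summable against [phi], and
    it serves the polynomial of coefficients [p] for a proportion [kappa] of
    the times up to [hi]. *)
Definition piece (phi : R -> R) (r0 : R) p d (rho e kappa : R) (i D : nat)
    (q : nat -> R[i]) (lo hi : nat) :=
  [/\ (D < lo)%N /\ (lo < hi)%N,
   forall m, ~~ ((lo <= m) && (m < hi))%N -> q m = 0,
   forall n K, (n <= D)%N -> \sum_(0 <= k < K)
     normc (q (n + k)%N) * iter_weight alpha n k * (1 - i.+2%:R^-1) ^+ k <= 2^-1 ^+ i.+1,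
   forall r, r0 <= r -> r < 1 -> M1 (psum q hi) r <= 2^-1 ^+ i.+1 * phi r &
   exists S : seq nat, [/\ uniq S, kappa * hi%:R <= (size S)%:R,
     forall n, n \in S -> (lo <= n <= hi)%N &
     forall n, n \in S -> forall K z, (hi <= K)%N -> normc z <= rho ->
     normc (psum (fun k => q (n + k)%N * (iter_weight alpha n k)%:C%C) K z
            - psum p d z) <= e]].

(** All the requirements hold once [N] is large; the proportion [1 / u] of good
    times depends on the spacing and the ratio only, hence not on [i], [D]. *)
Lemma piece_exists phi r0 p d (rho e : R) : majorant alpha phi r0 ->
  0 < rho < 1 -> 0 < e ->
  exists2 kappa, 0 < kappa & forall i D, exists q lo hi,
    piece phi r0 p d rho e kappa i D q lo hi.
Proof.
move=> [r001 _ maj] rho01 e0.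
have [s [t [s0 ds st approx]]] := block_params p d rho01 e0.
have t0 : (0 < t)%N by rewrite (leq_trans _ st)// muln_gt0 s0.
pose u := (t + 3 * s)%N.
have u0 : 0 < u%:R :> R by rewrite ltr0n addn_gt0 t0.
exists u%:R^-1 => [|i D]; first by rewrite invr_gt0.
pose W := weighted_norm alpha p d; have W0 : 0 <= W := weighted_norm_ge0 alpha p d.
have ei : 0 < 2^-1 ^+ i.+1 :> R by rewrite exprn_gt0// invr_gt0.
have W21 : 0 < 2 * W + 1 by lra.
have [X1 X1P] := maj _ _ W21 ei.
pose rho' : R := 1 - i.+2%:R^-1.
have rho'01 : 0 < rho' < 1.
  rewrite subr_gt0 invf_lt1 ?ltr0n// ltr1n /= ltrBlDr ltrDl invr_gt0 ltr0n//.
have /andP[rho'0 rho'1] := rho'01.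
(* The sum to be made small has at most [hi <= u X] non-zero terms, each at most
   [(D + 1) ^ |alpha| W X ^ |alpha| rho' ^ (X - D)]. *)
pose c := D.+1%:R `^ `|alpha| * (W + 1) * u%:R / rho' ^+ D.
have c0 : 0 < c.
  by rewrite divr_gt0 ?exprn_gt0// !mulr_gt0 ?powR_gt0//; lra.
have A1 : 0 <= `|alpha| + 1 by rewrite addr_ge0.
have [X2 X2P] := powR_geometric_cvg0 A1 rho'01 (divr_gt0 ei c0).
pose N := (maxn (maxn X1 X2) D).+1; pose X := (t * N)%N; pose hi := (X + 3 * N * s)%N.
have N0 : (0 < N)%N by [].
have NX : (N <= X)%N by rewrite leq_pmull.
have X10 : (X1 <= X)%N by rewrite (leq_trans _ NX)// leqW// !leq_max leqnn.
have X20 : (X2 <= X)%N by rewrite (leq_trans _ NX)// leqW// !leq_max leqnn orbT.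
have DX : (D < X)%N by rewrite (leq_trans _ NX)// ltnS leq_max leqnn orbT.
have X0 : (0 < X)%N by exact: leq_trans NX.
have hiE : hi = (u * N)%N by rewrite /hi /X /u mulnDl; congr (_ + _)%N; rewrite mulnAC.
exists (block alpha p d s X N), X, hi; split.
- by split=> //; rewrite /hi -addn1 leq_add2l !muln_gt0 N0 s0.
- move=> m; rewrite negb_and -ltnNge -leqNgt => /orP[/block_lo->//|].
  by apply: block_hi.
- move=> n K nD.
  pose b := W * X%:R `^ (- alpha) * D.+1%:R `^ `|alpha| * rho' ^+ (X - D).
  have b0 : 0 <= b by rewrite !mulr_ge0 ?powR_ge0 ?exprn_ge0// ltW.
  apply: (@le_trans _ _ (hi%:R * b)).
    apply: sum_bounded_support => // k; last first.
      move=> hk; rewrite block_hi ?ComplexField.Normc.normc0 ?mul0r//.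
      by rewrite (leq_trans hk)// leq_addl.
    have [nk|nk] := ltnP (n + k) X.
      by rewrite block_lo// ComplexField.Normc.normc0 !mul0r.
    rewrite ler_pM ?mulr_ge0 ?normc_ge0 ?powR_ge0 ?exprn_ge0 ?(ltW rho'0)//.
      rewrite ler_pM ?normc_ge0 ?powR_ge0//; first by rewrite mulrC block_le.
      rewrite (le_trans (iter_weight_le _ _))// ge0_ler_powR ?nnegrE//.
      by rewrite ler_nat ltnS.
    rewrite ler_wiXn2l ?(ltW rho'0) ?(ltW rho'1)//.
    by rewrite leq_subLR (leq_trans nk)// leq_add2r.
  have XR : 0 < X%:R :> R by rewrite ltr0n.
  have X1' : 1 <= X%:R :> R by rewrite ler1n.
  have := X2P X X20; rewrite ler_pdivlMr// => /(le_trans _); apply.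
  have hiX : hi%:R <= u%:R * X%:R :> R by rewrite hiE -natrM ler_nat leq_mul2l NX orbT.
  have XA : X%:R `^ (- alpha) <= X%:R `^ `|alpha|.
    by rewrite ler_powR// -normrN ler_norm.
  have -> : rho' ^+ X = rho' ^+ (X - D) * rho' ^+ D by rewrite -exprD subnK// ltnW.
  rewrite powRD; last by rewrite (gt_eqF XR) implybT.
  rewrite powRr1 ?(ltW XR)//.
  have -> : X%:R `^ `|alpha| * X%:R * (rho' ^+ (X - D) * rho' ^+ D) * c =
     (u%:R * X%:R) * ((W + 1) * X%:R `^ `|alpha| * D.+1%:R `^ `|alpha| * rho' ^+ (X - D)).
    by rewrite /c; field; rewrite gt_eqF// exprn_gt0.
  rewrite ler_pM// /b ler_wpM2r ?exprn_ge0 ?(ltW rho'0)// ler_wpM2r ?powR_ge0//.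
  by rewrite ler_pM ?powR_ge0//; lra.
- move=> r r0r r1; have r00 : 0 < r by case/andP: r001 => h _; exact: lt_le_trans r0r.
  have r01 : 0 < r < 1 by rewrite r00.
  rewrite (le_trans (M1_block alpha p X s0 ds N0 r01))//.
  rewrite (le_trans _ (X1P X X10 r r0r r1))// -/W.
  rewrite ler_wpM2r ?exprn_ge0 ?(ltW r00)// ler_wpM2r ?powR_ge0//; lra.
exists [seq (X + s * j)%N | j <- iota N N]; split.
- rewrite map_inj_uniq ?iota_uniq// => j k /addnI /eqP.
  by rewrite eqn_pmul2l// => /eqP.
- by rewrite size_map size_iota hiE natrM mulKf// gt_eqF.
- move=> n /mapP[j]; rewrite mem_iota => /andP[_ jN] ->.
  rewrite leq_addr leq_add2l mulnC leq_mul2r; apply/orP; right.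
  by rewrite (leq_trans (ltnW jN))// addnn -mul2n leq_mul2r orbT.
move=> n /mapP[j]; rewrite mem_iota => /andP[Nj jN] -> K z hK zr.
apply: approx => //; first by rewrite Nj mul2n -addnn.
by rewrite (leq_trans _ hK)// /hi (leq_trans _ (leq_addl _ _))// leq_pmull.
Qed.

End Piece.

(** * Superposing infinitely many blocks *)

Section Assembly.
Variables (R : realType) (alpha : R) (phi : R -> R) (r0 : R) (T : Type).
Variables (p : T -> nat -> R[i]) (d : T -> nat) (rho e kappa : T -> R).
Hypothesis phi_maj : majorant alpha phi r0.
Hypothesis pieces : forall x i D, exists q lo hi,
  piece alpha phi r0 (p x) (d x) (rho x) (e x) (kappa x) i D q lo hi.
Variable request : nat -> T.

Lemma half_sum n m : \sum_(n <= i < m) (2^-1 : R) ^+ i.+1 <= 2^-1 ^+ n.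
Proof.
have [mn|nm] := leqP m n; first by rewrite big_geq// exprn_ge0.
have h01 : 0 <= (2^-1 : R) < 1 by rewrite invr_ge0 invf_lt1// ltr1n ler0n.
have := geo_sum_le n (m - n) h01; rewrite subnKC ?(ltnW nm)// => h.
under eq_bigr do rewrite exprS.
rewrite -mulr_sumr (le_trans (ler_wpM2l _ h)) ?invr_ge0//.
by rewrite le_eqVlt; apply/orP; left; apply/eqP; field.
Qed.

(** Each piece is chosen once the end of the previous one is known. *)
Lemma piece_sequence : exists (q : nat -> nat -> R[i]) (lo hi : nat -> nat),
  (forall i j, (i < j)%N -> (hi i < lo j)%N) /\ (forall i, (i < lo i)%N) /\
  (forall i, exists D, (forall j, (j < i)%N -> (hi j <= D)%N) /\
     piece alpha phi r0 (p (request i)) (d (request i)) (rho (request i))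
       (e (request i)) (kappa (request i)) i D (q i) (lo i) (hi i)).
Proof.
have [F FP] : {F : T * nat * nat -> (nat -> R[i]) * nat * nat & forall y,
    piece alpha phi r0 (p y.1.1) (d y.1.1) (rho y.1.1) (e y.1.1) (kappa y.1.1)
      y.1.2 y.2 (F y).1.1 (F y).1.2 (F y).2}.
  apply: (@choice _ _ (fun y v => piece alpha phi r0 (p y.1.1) (d y.1.1)
    (rho y.1.1) (e y.1.1) (kappa y.1.1) y.1.2 y.2 v.1.1 v.1.2 v.2)).
  move=> [[x i] D]; have [q [lo [hi h]]] := pieces x i D.
  by exists (q, lo, hi).
pose B := fix B i := F (request i, i, if i is j.+1 then (B j).2 else 0%N).
pose q i := (B i).1.1; pose lo i := (B i).1.2; pose hi i := (B i).2.
pose D i := if i is j.+1 then hi j else 0%N.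
have BP i : piece alpha phi r0 (p (request i)) (d (request i)) (rho (request i))
       (e (request i)) (kappa (request i)) i (D i) (q i) (lo i) (hi i).
  by case: i => [|i]; [exact: (FP (request 0%N, 0%N, 0%N))
                      |exact: (FP (request i.+1, i.+1, hi i))].
have lohi i : (D i < lo i)%N /\ (lo i < hi i)%N by case: (BP i).
have hilo i j : (i < j)%N -> (hi i < lo j)%N.
  elim: j => // j IH; rewrite ltnS leq_eqVlt => /orP[/eqP ->|/IH h].
    exact: (lohi j.+1).1.
  exact: ltn_trans h (ltn_trans (lohi j).2 (lohi j.+1).1).
exists q, lo, hi; split=> //; split=> [|i].
  elim=> [|i IH]; first exact: leq_ltn_trans (lohi 0%N).1.
  by rewrite (leq_ltn_trans IH)// (ltn_trans (lohi i).2)// hilo.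
exists (D i); split=> // -[|j] //; case: i => // i; rewrite ltnS /=.
  by case: i => // i _; rewrite ltnW// (ltn_trans (hilo 0%N i.+1 _))// (lohi _).2.
rewrite leq_eqVlt => /orP[/eqP ->//|ji].
by rewrite ltnW// (ltn_trans (hilo _ _ ji))// (lohi _).2.
Qed.

(** At a time [n] served by the [i]-th piece, [T^n] annihilates the earlier
    pieces, whose degrees are less than [n], and the later ones contribute at
    most [\sum_(j > i) 2 ^ - (j + 1)]. *)
Lemma assembly : exists f : R[i] -> R[i], [/\ analytic_disc f,
  forall r, r0 <= r -> r < 1 -> M1 f r <= phi r &
  forall i, exists (hi : nat) (S : seq nat), [/\ (i < hi)%N, uniq S,
    kappa (request i) * hi%:R <= (size S)%:R,
    forall n, n \in S -> (0 < n <= hi)%N &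
    forall n, n \in S -> forall z, normc z <= rho (request i) ->
      normc z <= 1 - i.+2%:R^-1 ->
      normc (iter n (taylor_shift alpha) f z - psum (p (request i)) (d (request i)) z)
      <= e (request i) + 2^-1 ^+ i]].
Proof.
have [q [lo [hi [hilo [ilo qP]]]]] := piece_sequence.
have lohi i : (lo i < hi i)%N by have [D [_ [[_ ? _ _ _]]]] := qP i.
have q0 i m : ~~ ((lo i <= m) && (m < hi i))%N -> q i m = 0.
  by have [D [_ [_ + _ _ _]]] := qP i; exact.
have qsmall i n K : n = 0%N \/ (exists2 j, (j < i)%N & (n <= hi j)%N) ->
    \sum_(0 <= k < K) normc (q i (n + k)%N) * iter_weight alpha n k *
      (1 - i.+2%:R^-1) ^+ k <= 2^-1 ^+ i.+1.
  have [D [hD [_ _ small _ _]]] := qP i; move=> nD; apply: small.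
  by case: nD => [->//|[j ji /leq_trans]]; apply; exact: hD.
pose rh i : R := 1 - i.+2%:R^-1.
have rh0 i : 0 <= rh i by rewrite subr_ge0 invf_le1 ?ler1n// ltr0n.
have rh_le i j : (i <= j)%N -> rh i <= rh j.
  by move=> ij; rewrite lerD2l lerN2 lef_pV2 ?posrE ?ltr0n// ler_nat !ltnS.
pose a m := \sum_(0 <= i < m.+1) q i m.
have aE I m : (m < I)%N -> a m = \sum_(0 <= i < I) q i m.
  move=> mI; rewrite [RHS](big_cat_nat (n := m.+1)) ?leq0n//= [X in _ + X]big_nat_cond.
  rewrite [X in _ + X]big1 ?addr0// => i; rewrite andbT => /andP[mi _].
  by apply: q0; rewrite negb_and -ltnNge (ltn_trans mi (ilo i)).
have termE I n k (w z : R[i]) : (n + k < I)%N ->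
    a (n + k)%N * w * z ^+ k = \sum_(0 <= i < I) q i (n + k)%N * w * z ^+ k.
  by move=> /aE ->; rewrite !mulr_suml.
have psumE n K (w : nat -> R[i]) z : psum (fun k => a (n + k)%N * w k) K z =
    \sum_(0 <= i < n + K) psum (fun k => q i (n + k)%N * w k) K z.
  rewrite /psum exchange_big /=; apply: eq_big_nat => k /andP[_ kK].
  by rewrite (termE (n + K)%N)// ltn_add2l.
have psum_small i n K z : n = 0%N \/ (exists2 j, (j < i)%N & (n <= hi j)%N) ->
    normc z <= rh i ->
    normc (psum (fun k => q i (n + k)%N * (iter_weight alpha n k)%:C%C) K z) <= 2^-1 ^+ i.+1.
  move=> nD zi; rewrite (le_trans (normc_sum _ _ _))// (le_trans _ (qsmall i n K nD))//.
  apply: ler_sum => k _; rewrite !ComplexField.Normc.normcM normcX normc_real.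
  rewrite ger0_norm ?powR_ge0// ler_wpM2l ?mulr_ge0 ?normc_ge0 ?powR_ge0//.
  by rewrite -/(rh i) lerXn2r ?nnegrE ?normc_ge0 ?rh0.
have ta : tame a.
  move=> r /andP[r00 r1].
  have d0 : 0 < 1 - r by rewrite subr_gt0.
  (* From [i0] on, the pieces are small on a disc of radius at least [r]. *)
  pose i0 := Num.truncn (1 - r)^-1.
  have rrh i : (i0 <= i)%N -> r <= rh i.
    move=> i0i; rewrite lerBrDr -lerBrDl -[leRHS]invrK lef_pV2 ?posrE ?invr_gt0 ?ltr0n//.
    by rewrite ltW// (lt_le_trans (truncnS_gt _))// ler_nat ltnS leqW.
  pose M := \sum_(0 <= i < i0) \sum_(0 <= m < hi i) normc (q i m).
  have M0 : 0 <= M by apply: sumr_ge0 => i _; apply: sumr_ge0 => m _; exact: normc_ge0.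
  exists (M + 1) => [|m]; first by rewrite addr_ge0.
  pose I := maxn m.+1 i0.
  rewrite (aE I) ?leq_max ?leqnn//.
  rewrite (le_trans (ler_wpM2r (exprn_ge0 _ (ltW r00)) (normc_sum _ _ _)))// mulr_suml.
  rewrite (big_cat_nat (n := i0)) ?leq0n ?leq_max ?leqnn ?orbT//= lerD//.
    apply: ler_sum_nat => i _.
    rewrite (@le_trans _ _ (normc (q i m)))//.
      by rewrite ler_piMr ?normc_ge0// exprn_ile1// ltW.
    have [mi|im] := ltnP m (hi i).
      rewrite (bigD1_seq m) ?mem_index_iota ?iota_uniq//= lerDl.
      by apply: sumr_ge0 => k _; exact: normc_ge0.
    rewrite q0 ?ComplexField.Normc.normc0 ?sumr_ge0// => [k _|]; first exact: normc_ge0.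
    by rewrite negb_and -!leqNgt im orbT.
  apply: (@le_trans _ _ (\sum_(i0 <= i < I) 2^-1 ^+ i.+1)).
    apply: ler_sum_nat => i /andP[i0i _].
    rewrite (le_trans _ (qsmall i 0%N m.+1 (or_introl erefl)))//.
    rewrite big_nat_recr//= add0n iter_weight0 mulr1 ler_wpDl//.
      apply: sumr_ge0 => k _.
      by rewrite -/(rh i) !mulr_ge0 ?normc_ge0 ?powR_ge0 ?exprn_ge0 ?rh0.
    by rewrite ler_wpM2l ?normc_ge0// -/(rh i) lerXn2r ?nnegrE ?(ltW r00) ?rh0// rrh.
  by rewrite (le_trans (half_sum _ _))// exprn_ile1 ?invr_ge0// invf_le1// ler1n.
have [f af] := tame_sums ta.
have [r001 phi0 _] := phi_maj.
exists f; split; first exact: sums_analytic af.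
- move=> r r0r r1; have r00 : 0 < r by case/andP: r001 => h _; exact: lt_le_trans r0r.
  have r01 : 0 < r < 1 by rewrite r00.
  apply/ler_addgt0Pr => eps eps0.
  pose s := (1 + r) / 2.
  have s01 : 0 < s < 1 by rewrite /s; lra.
  have rs01 : 0 <= r < s by rewrite /s; lra.
  have [M M0 aM] := sums_tame af s01.
  have q01 : 0 <= r / s < 1.
    by case/andP: s01 => s0 _; rewrite divr_ge0 ?(ltW r00) ?(ltW s0)//= ltr_pdivrMr// mul1r; lra.
  have [J JP] := geo_small (M / (1 - r / s)) q01 eps0.
  pose K := hi J.
  have JK : (J < K)%N by exact: ltn_trans (ilo J) (lohi J).
  have aK : psum a K = fun z => \sum_(0 <= i < J.+1) psum (q i) (hi i) z.
    apply/funext => z.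
    transitivity (\sum_(0 <= i < K) psum (q i) K z).
      rewrite /psum exchange_big /=; apply: eq_big_nat => k /andP[_ kK].
      by rewrite (aE K)// mulr_suml.
    rewrite (big_cat_nat (n := J.+1)) ?leq0n//= [X in _ + X]big_nat_cond.
    rewrite [X in _ + X]big1 ?addr0 => [|i]; last first.
      rewrite andbT => /andP[Ji _]; rewrite /psum big_nat_cond big1// => k.
      rewrite andbT => /andP[_ kK]; rewrite q0 ?mul0r//.
      by rewrite negb_and -ltnNge (ltn_trans kK (hilo _ _ Ji)).
    apply: eq_big_nat => i /andP[_ iJ].
    have hiK : (hi i <= K)%N.
      move: iJ; rewrite ltnS leq_eqVlt => /orP[/eqP->//|iJ].
      by rewrite ltnW// (ltn_trans (hilo _ _ iJ)).
    rewrite /psum (big_cat_nat (n := hi i)) ?leq0n//= [X in _ + X]big_nat_cond.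
    rewrite [X in _ + X]big1 ?addr0// => k; rewrite andbT => /andP[ik _].
    by rewrite q0 ?mul0r// negb_and -!leqNgt ik orbT.
  apply: (@le_trans _ _ (M1 (psum a K) r + eps)).
    apply: M1_close => //; [exact: sums_analytic af|exact: psum_analytic|].
    move=> z zr; have zd : disc z by apply/discP; rewrite zr.
    rewrite normcB (le_trans (psum_tail _ rs01 aM _ (af _ zd))) ?zr//.
    by rewrite mulrAC ltW// JP// ltnW.
  rewrite lerD2r; have := @psum_analytic _ a K; rewrite aK => sA.
  apply: le_trans (@M1_sum R nat (index_iota 0 J.+1) (fun i => psum (q i) (hi i)) r r01
    (fun i => @psum_analytic R (q i) (hi i)) sA) _.
  apply: (@le_trans _ _ (\sum_(0 <= i < J.+1) 2^-1 ^+ i.+1 * phi r)).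
    by apply: ler_sum => i _; have [D [_ [_ _ _ h _]]] := qP i; exact: h.
  rewrite -mulr_suml ler_piMl ?phi0// (le_trans (half_sum _ _))//.
move=> i; have [D [_ [[_ _] _ _ _ [S [uS kS Slo SP]]]]] := qP i.
exists (hi i), S; split=> //.
- exact: ltn_trans (ilo i) (lohi i).
- move=> n nS; have /andP[n1 ->] := Slo n nS.
  by rewrite (leq_trans _ n1)// (leq_ltn_trans _ (ilo i)).
move=> n nS z zrho zi.
have z1 : normc z < 1.
  by rewrite (le_lt_trans zi)// ltrBlDr ltrDl invr_gt0 ltr0n.
have zd : disc z by apply/discP.
have /cvgcP bz := @sums_iter _ alpha _ _ n af z zd.
apply/ler_addgt0Pr => eps eps0.
have [n0 n0P] := bz _ eps0.
pose K := maxn n0 (hi i).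
have iK : (i < n + K)%N.
  by rewrite (leq_trans (ltn_trans (ilo i) (lohi i)))// (leq_trans _ (leq_addl _ _))// leq_maxr.
have := n0P K (leq_maxl _ _); rewrite normcB => hK.
set b := psum _ K z in hK.
have -> : iter n (taylor_shift alpha) f z - psum (p (request i)) (d (request i)) z =
   (iter n (taylor_shift alpha) f z - b) + (b - psum (p (request i)) (d (request i)) z).
  by rewrite addrA subrK.
rewrite (le_trans (le_normcD _ _))// addrC lerD//; last exact: ltW.
rewrite /b psumE (big_cat_nat (n := i)) ?leq0n ?(ltnW iK)//= big_nat_cond big1 ?add0r.
  rewrite big_ltn// addrAC (le_trans (le_normcD _ _))// lerD//.
    exact: (SP n nS K z (leq_maxr _ _) zrho).
  rewrite (le_trans (normc_sum _ _ _))//.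
  apply: (@le_trans _ _ (\sum_(i.+1 <= j < n + K) 2^-1 ^+ j.+1)).
    apply: ler_sum_nat => j /andP[ij _]; apply: psum_small.
      by right; exists i => //; case/andP: (Slo n nS).
    by rewrite (le_trans zi)// rh_le// ltnW.
  rewrite (le_trans (half_sum _ _))// exprS ler_piMl ?exprn_ge0//.
  by rewrite invf_le1// ler1n.
move=> j; rewrite andbT => /andP[_ ji].
rewrite /psum big1// => k _; rewrite q0 ?mul0r//.
rewrite negb_and -!leqNgt; apply/orP; right.
have /andP[n1 _] := Slo n nS.
by rewrite (leq_trans (ltnW (hilo _ _ ji)))// (leq_trans n1)// leq_addr.
Qed.

End Assembly.

(** * Neighbourhoods, density and rational polynomials *)

Section Topology.
Variable R : realType.
Implicit Types (g h : R[i] -> R[i]).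

Lemma compact_disc_radius (K : set R[i]) : compact K -> K `<=` @disc R ->
  exists2 rho : R, rho < 1 & forall z, K z -> normc z <= rho.
Proof.
move=> cK KD; have [K0|/set0P/negP] := pselect (K !=set0); last first.
  by rewrite negbK => /eqP ->; exists 0.
have [|c] := @compact_EVT_max _ _ (@normc R) K K0 cK.
  by apply: continuous_subspaceT; exact: normc_continuous.
rewrite inE => /KD/discP c1 cmax; exists (normc c) => // z Kz.
by apply: cmax; rewrite inE.
Qed.

Lemma entourage_normcP (E : set (R[i] * R[i])) : entourage E ->
  exists2 e : R, 0 < e & forall x y, normc (x - y) < e -> E (x, y).
Proof.
rewrite -entourage_ballE => -[_ /posC[e e0 ->] sub]; exists e => // x y xy.
by apply: sub; rewrite /= -ball_normE /= normrcE ltcR.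
Qed.

(** The closed discs of radius [1 - 1 / (j + 2)] exhaust the disc, so they
    suffice to describe neighbourhoods in the compact-open topology. *)
Lemma open_compact_convergence (U : set (compact_convergence R)) g : open U -> U g ->
  exists j, forall h, (forall z, normc z <= 1 - j.+2%:R^-1 ->
    normc (h z - g z) <= j.+1%:R^-1) -> U h.
Proof.
move=> oU Ug; apply: contrapT => nj.
have H : forall j, exists h, (forall z, normc z <= 1 - j.+2%:R^-1 ->
    normc (h z - g z) <= j.+1%:R^-1) /\ ~ U h.
  move=> j; apply: contrapT => nh; apply: nj; exists j => h hg.
  by apply: contrapT => nU; apply: nh; exists h.
have [h hP] := choice H.
have hg : {family (fun K : set R[i] => compact K /\ K `<=` @disc R), h @ \oo --> g}.
  apply/fam_cvgP => K [cK KD] P /uniform_nbhs[E [entE sub]].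
  have [rho rho1 Krho] := compact_disc_radius cK KD.
  have [e e0 eE] := entourage_normcP entE.
  pose n0 := maxn (Num.truncn (1 - rho)^-1) (Num.truncn e^-1).
  exists n0 => // n /= n0n; apply: sub => z Kz; apply: eE.
  have d0 : 0 < 1 - rho by rewrite subr_gt0.
  have [hn _] := hP n; rewrite normcB (le_lt_trans (hn z _))//.
    rewrite (le_trans (Krho z Kz))// lerBrDr -lerBrDl -[leRHS]invrK.
    rewrite lef_pV2 ?posrE ?invr_gt0 ?ltr0n//.
    rewrite ltW// (lt_le_trans (truncnS_gt _))// ler_nat ltnS leqW//.
    by rewrite (leq_trans _ n0n)// leq_maxl.
  rewrite invf_plt ?posrE ?ltr0n// (lt_le_trans (truncnS_gt _))// ler_nat ltnS.
  by rewrite (leq_trans _ n0n)// leq_maxr.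
have [n0 _ n0U] : \forall n \near \oo, U (h n).
  by apply: hg; apply: open_nbhs_nbhs; split.
by have [_] := hP n0; apply; exact: (n0U n0 (leqnn _)).
Qed.

Lemma density_lower (A : set nat) (kappa : R) : 0 < kappa ->
  (forall m, exists (hi : nat) (S : seq nat), [/\ (m < hi)%N, uniq S,
     kappa * hi%:R <= (size S)%:R &
     forall n, n \in S -> (0 < n <= hi)%N /\ A n]) ->
  (0 < upper_density R A)%E.
Proof.
move=> k0 H; apply: (@lt_le_trans _ _ kappa%:E); first by rewrite lte_fin.
apply: le_ereal_inf_tmp => _ [V [m _ mV] <-].
have [hi [S [mhi uS kS SA]]] := H m.
apply: le_trans (ereal_sup_ubound _); last by exists hi => //; apply: mV; exact: ltnW.
have hi0 : 0 < hi%:R :> R by rewrite ltr0n (leq_ltn_trans _ mhi).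
rewrite lee_fin ler_pdivlMr// (le_trans kS)// ler_nat.
rewrite -big_mkcond /= sum1_count -size_filter; apply: uniq_leq_size => // n nS.
have [/andP[n0 nhi] An] := SA n nS.
by rewrite mem_filter mem_index_iota n0 ltnS nhi !andbT inE.
Qed.

Lemma rational_approx (x e : R) : 0 < e -> exists q : rat, `|ratr q - x| < e.
Proof.
move=> e0; have [|q] := @rat_in_itvoo R (x - e) (x + e); first by lra.
rewrite in_itv /= => /andP[q1 q2]; exists q; rewrite ltr_norml; lra.
Qed.

Definition rational_coef (s : seq (rat * rat)) k : R[i] :=
  (ratr (nth (0, 0) s k).1 +i* ratr (nth (0, 0) s k).2)%C.

(** A partial sum of the Taylor series, with its coefficients perturbed. *)
Lemma rational_dense g (rho e : R) : analytic_disc g -> 0 <= rho < 1 -> 0 < e ->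
  exists s, forall z, normc z <= rho ->
    normc (psum (rational_coef s) (size s) z - g z) <= e.
Proof.
move=> /taylor[b bg] /andP[r0 r1] e0.
pose r := (1 + rho) / 2.
have r01 : 0 < r < 1 by rewrite /r; lra.
have rr : 0 <= rho < r by rewrite /r; lra.
have [M M0 bM] := sums_tame bg r01.
have q01 : 0 <= rho / r < 1.
  by case/andP: r01 => h _; rewrite divr_ge0 ?(ltW h)//= ltr_pdivrMr// mul1r; lra.
have e2 : 0 < e / 2 by rewrite divr_gt0.
have [K KP] := geo_small (M / (1 - rho / r)) q01 e2.
pose eta := e / 4 / K.+1%:R.
have eta0 : 0 < eta by rewrite !divr_gt0// ltr0n.
have [x xP] := choice (fun k => rational_approx (complex.Re (b k)) eta0).
have [y yP] := choice (fun k => rational_approx (complex.Im (b k)) eta0).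
exists (mkseq (fun k => (x k, y k)) K) => z zr; rewrite size_mkseq.
have -> : psum (rational_coef (mkseq (fun k => (x k, y k)) K)) K z - g z =
    (psum (rational_coef (mkseq (fun k => (x k, y k)) K)) K z - psum b K z) +
    (psum b K z - g z) by rewrite addrA subrK.
rewrite (le_trans (le_normcD _ _))// [leRHS]splitr lerD//; last first.
  have zd : disc z by apply/discP; exact: le_lt_trans zr r1.
  rewrite (le_trans (psum_tail K rr bM zr (bg z zd)))// mulrAC.
  exact: ltW (KP K (leqnn K)).
rewrite /psum -sumrB (le_trans (normc_sum _ _ _))//.
rewrite (@le_trans _ _ (\sum_(0 <= k < K) 2 * eta))//.
  apply: ler_sum_nat => k /andP[_ kK].
  rewrite -mulrBl ComplexField.Normc.normcM normcX.
  rewrite (@le_trans _ _ (normc (rational_coef (mkseq (fun k => (x k, y k)) K) k - b k)))//.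
    rewrite ler_piMr ?normc_ge0// exprn_ile1 ?normc_ge0//.
    by rewrite (le_trans zr)// ltW.
  rewrite (le_trans (normc_le_ReIm _))// /rational_coef nth_mkseq//=.
  have := xP k; have := yP k; case: (b k) => u v /= h1 h2; lra.
rewrite sumr_const_nat subn0 -[leLHS]mulr_natl /eta.
have K0 : 0 < K.+1%:R :> R by rewrite ltr0n.
have KK : K%:R / K.+1%:R <= 1 :> R by rewrite ler_pdivrMr// mul1r ler_nat.
move: K0 KK; move: (K.+1%:R : R) (K%:R : R) => u v u0 vu.
rewrite (_ : _ * _ = e / 2 * (v / u)); last by field; rewrite gt_eqF.
have := ler_wpM2l (ltW e2) vu; lra.
Qed.

End Topology.

(** Enumerate the pairs of a value and a repetition index, and forget the
    index. *)
Lemma recurrent_enumeration (T : countType) (x0 : T) :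
  exists r : nat -> T, forall x m, exists2 i, (m <= i)%N & r i = x.
Proof.
exists (fun i => if @unpickle (T * nat)%type i is Some (x, _) then x else x0).
move=> x m; have [k km] : exists k : nat, (m <= @pickle (T * nat)%type (x, k))%N.
  apply: contrapT => nk.
  have : (size (map (fun k : nat => @pickle (T * nat)%type (x, k)) (iota 0 m.+1)) <= size (iota 0 m))%N.
    apply: uniq_leq_size.
      rewrite map_inj_uniq ?iota_uniq// => k l.
      by move=> /(pcan_inj (@pickleK (T * nat)%type)) [->].
    move=> i /mapP[k _ ->]; rewrite mem_iota /= ltnNge.
    by apply/negP => h; apply: nk; exists k.
  by rewrite size_map !size_iota ltnn.
by exists (@pickle (T * nat)%type (x, k)); rewrite // pickleK.
Qed.

(** * Optimality *)

Section UpperBound.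
Variables (R : realType) (alpha : R).

(** The requests are the Gaussian rational polynomials together with a
    precision. Each occurs infinitely often with the same [kappa], so that a
    proportion [kappa] of good times is met at infinitely many [hi]. *)
Lemma majorant_realized (phi : R -> R) r0 : majorant alpha phi r0 ->
  exists f : R[i] -> R[i], U_frequently_hypercyclic alpha f /\
    forall r, r0 <= r -> r < 1 -> M1 f r <= phi r.
Proof.
move=> maj; pose T : countType := (seq (rat * rat) * nat)%type.
pose p (x : T) := @rational_coef R x.1; pose d (x : T) := size x.1.
pose rho (x : T) : R := 1 - x.2.+2%:R^-1; pose e (x : T) : R := x.2.+1%:R^-1.
have rho01 x : 0 < rho x < 1.
  by rewrite subr_gt0 invf_lt1 ?ltr0n// ltr1n /= ltrBlDr ltrDl invr_gt0 ltr0n.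
have e0 x : 0 < e x by rewrite invr_gt0 ltr0n.
have H x : exists kappa, 0 < kappa /\ forall i D, exists q lo hi,
    piece alpha phi r0 (p x) (d x) (rho x) (e x) kappa i D q lo hi.
  by have [k k0 kP] := piece_exists (p x) (d x) maj (rho01 x) (e0 x); exists k.
have [kappa kP] := choice H.
have [req reqP] := recurrent_enumeration (([::], 0%N) : T).
have [f [fA fM fP]] := assembly maj (fun x => (kP x).2) req.
exists f; split=> //; split=> // U oU [g [Ug gA]].
have [j jP] := open_compact_convergence oU Ug.
(* The tolerance [1 / (j + 1)] is shared by the request, its approximation and
   the pieces that come after the one serving it. *)
pose t := (3 * j.+1)%N.
have eta0 : 0 < (t.+1%:R^-1 : R) by rewrite invr_gt0 ltr0n.
have rhoj01 : 0 <= 1 - (t.+2%:R^-1 : R) < 1.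
  by rewrite subr_ge0 invf_le1 ?ltr0n// ler1n /= ltrBlDr ltrDl invr_gt0 ltr0n.
have [s sP] := rational_dense gA rhoj01 eta0.
pose x : T := (s, t).
have h01 : 0 <= (2^-1 : R) < 1 by rewrite invr_ge0 invf_lt1// ltr1n ler0n.
have [i0 i0P] := geo_small 1 h01 eta0.
apply: (@density_lower _ _ (kappa x) (kP x).1) => m.
have [i mi reqi] := reqP x (maxn m (maxn i0 t)).
have [hi [S [ihi uS kS Shi Sf]]] := fP i.
rewrite reqi in kS Sf.
move: mi; rewrite !geq_max => /and3P[mi i0i ti].
exists hi, S; split=> //; first exact: leq_ltn_trans ihi.
move=> n nS; split; first exact: Shi.
rewrite /mkset; apply: jP => z zj.
have jt : 1 - j.+2%:R^-1 <= 1 - t.+2%:R^-1 :> R.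
  rewrite lerD2l lerN2 lef_pV2 ?posrE ?ltr0n// ler_nat !ltnS /t.
  by rewrite (leq_trans (leqnSn j))// leq_pmull.
have zt := le_trans zj jt.
have zi : normc z <= 1 - i.+2%:R^-1.
  by rewrite (le_trans zt)// lerD2l lerN2 lef_pV2 ?posrE ?ltr0n// ler_nat !ltnS.
have h1 := Sf n nS z zt zi; have h2 := sP z zt.
have h3 := i0P i i0i; rewrite mul1r in h3.
have -> : iter n (taylor_shift alpha) f z - g z =
  (iter n (taylor_shift alpha) f z - psum (p x) (d x) z) +
  (psum (rational_coef R s) (size s) z - g z) by rewrite addrA subrK.
rewrite (le_trans (le_normcD _ _))//.
have h4 : 3 * t.+1%:R^-1 <= j.+1%:R^-1 :> R.
  rewrite ler_pdivrMr ?ltr0n// [leRHS]mulrC ler_pdivlMr ?ltr0n//.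
  by rewrite -natrM ler_nat leqnSn.
apply: le_trans (lerD h1 h2) _; have -> : e x = t.+1%:R^-1 by [].
move: h3 h4; move: (t.+1%:R^-1 : R) (2^-1 ^+ i : R) (j.+1%:R^-1 : R) => u v w.
lra.
Qed.

End UpperBound.

Theorem theorem3p4 (R : realType) (alpha : R) :
  (forall f : R[i] -> R[i], U_frequently_hypercyclic alpha f ->
     (alpha <= 0 ->
        limf_esup (fun r : R => ((1 - r) `^ (- alpha) * M1 f r)%:E) 1^'-
        = +oo%E) /\
     (0 < alpha -> (0 < limf_esup (fun r : R => (M1 f r)%:E) 1^'-)%E)) /\
  (alpha != 0 -> forall l : nat, (1 <= l)%N ->
     exists f : R[i] -> R[i], U_frequently_hypercyclic alpha f /\
     exists C : R, 0 < C /\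
       \forall r \near 1^'-,
         M1 f r <= if alpha < 0
                   then C * (1 - r) `^ alpha * iter_log l (- ln (1 - r))
                   else C).
Proof.
split=> [f fU|a0 l _].
  by split=> _; [exact: limsup_M1_infty|exact: limsup_M1_gt0 fU].
have [a_lt0|a_ge0] := ltP alpha 0.
  have [r0 maj] := majorant_neg l a_lt0; have [/andP[_ r01] _ _] := maj.
  have [f [fU fM]] := majorant_realized maj.
  exists f; split=> //; exists 1; split=> //.
  near=> r; rewrite mul1r; apply: fM; near: r; first exact: nbhs_left_ge.
  exact: nbhs_left_lt.
have a_gt0 : 0 < alpha by rewrite lt_neqAle eq_sym a0.
have [f [fU fM]] := majorant_realized (majorant_pos a_gt0).
exists f; split=> //; exists 1; split=> //.
near=> r; apply: fM; near: r; first by apply: nbhs_left_ge; lra.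
exact: nbhs_left_lt.
Unshelve. all: end_near. Qed.
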